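(* Let $\mathbf{Q}(t)=(Q_1(t),\ldots,Q_K(t))$, $t\in\{0,1,2,\ldots\}$, be a stochastic vector process with real-valued components and let $p(t)$ be a real-valued stochastic process on the same probability space. Let $\mathcal{H}(0)=\{\mathbf{Q}(0)\}$ and, for $t>0$, $\mathcal{H}(t)=\{\mathbf{Q}(0),\ldots,\mathbf{Q}(t),p(0),\ldots,p(t-1)\}$. Let $L(\mathbf{Q})=\frac{1}{2}\sum_{k=1}^K w_kQ_k^2$ with constants $w_k>0$, and $\Delta(\mathcal{H}(t))=\mathbb{E}[L(\mathbf{Q}(t+1))-L(\mathbf{Q}(t))\mid \mathcal{H}(t)]$. Assume: (i) $\mathbb{E}[p(t)^2]<\infty$ for all $t$ and $\sum_{\tau=1}^\infty \mathbb{E}[p(\tau)^2]/\tau^2<\infty$; (ii) there is a finite (possibly negative) constant $p_{min}$ with $\mathbb{E}[p(t)\mid\mathcal{H}(t)]\geq p_{min}$ for all $t$ and all possible $\mathcal{H}(t)$; (iii) there is a finite constant $D>0$ with $\mathbb{E}[(Q_k(t+1)-Q_k(t))^4\mid \mathbf{Q}(t)]\leq D$ for all $t$, all possible $\mathbf{Q}(t)$ and all $k\in\{1,\ldots,K\}$; (iv) $\mathbf{Q}(0)$ is finite with probability 1; (v) there are finite constants $B$, $p^*$, $V>0$, $\epsilon>0$ such that for all $t$ and all possible $\mathcal{H}(t)$, $$\Delta(\mathcal{H}(t))+V\,\mathbb{E}[p(t)\mid\mathcal{H}(t)]\leq B+Vp^*-\epsilon\sum_{k=1}^K|Q_k(t)|.$$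 Then with probability 1, $$\limsup_{t\to\infty}\frac{1}{t}\sum_{\tau=0}^{t-1}p(\tau)\leq p^*+\frac{B}{V},\qquad \limsup_{t\to\infty}\frac{1}{t}\sum_{\tau=0}^{t-1}\sum_{k=1}^K|Q_k(\tau)|\leq \frac{B+V(p^*-p_{min})}{\epsilon},$$ and for every $k\in\{1,\ldots,K\}$, $\lim_{t\to\infty}Q_k(t)/t=0$ with probability 1. Finally, if the inequality in (v) holds with $V=0$ (and the other assumptions hold), then the second bound above (with $V=0$) and $\lim_{t\to\infty}Q_k(t)/t=0$ w.p.1 for all $k$ still hold.
   Context: Time is slotted, $t\in\{0,1,2,\ldots\}$. ''For all possible $\mathcal{H}(t)$'' means for every realization of the history (i.e., almost surely). The conditional expectation $\mathbb{E}[\cdot\mid\mathcal{H}(t)]$ is with respect to the information $\mathbf{Q}(0),\ldots,\mathbf{Q}(t),p(0),\ldots,p(t-1)$. *)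

(* Defs.v *)
From HB Require Import structures.
From mathcomp Require Import all_boot all_order all_algebra.
From mathcomp Require Import all_classical all_reals all_analysis.
Import Order.TTheory GRing.Theory Num.Theory.
Import numFieldNormedType.Exports.
Set Implicit Arguments. Unset Strict Implicit. Unset Printing Implicit Defensive.
Local Open Scope classical_set_scope.
Local Open Scope ring_scope.

Section Defs.
Context {d : measure_display} {T : measurableType d} {R : realType}.

Definition hist_sigma (K : nat) (Q : nat -> 'I_K -> T -> R) (p : nat -> T -> R)
  (t : nat) : set (set T) :=
  <<s [set A | (exists s k (B : set R), (s <= t)%N /\ measurable B /\ A = Q s k @^-1` B)
            \/ (exists s (B : set R), (s < t)%N /\ measurable B /\ A = p s @^-1` B)] >>.

Definition state_sigma (K : nat) (Q : nat -> 'I_K -> T -> R) (t : nat) : set (set T) :=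
  <<s [set A | exists k (B : set R), measurable B /\ A = Q t k @^-1` B] >>.

Definition G_measurable (G : set (set T)) (g : T -> R) : Prop :=
  forall B : set R, measurable B -> G (g @^-1` B).

(* g is a version of the (generalized) conditional expectation E[X | G]:
   g is G-measurable and there is a cover of T by sets A n in G on which
   X and g are integrable and for all C in G, the integrals of X and g over
   C `&` A n agree.  When X is integrable this is the usual definition
   (take A n = setT). *)
Definition is_cond_exp (P : {measure set T -> \bar R}) (G : set (set T))
  (X g : T -> R) : Prop :=
  G_measurable G g /\
  exists A : nat -> set T,
    (forall n, G (A n)) /\ \bigcup_n A n = setT /\
    forall n, P.-integrable (A n) (EFin \o X) /\ P.-integrable (A n) (EFin \o g) /\
      forall C, G C ->
        (\int[P]_(x in C `&` A n) (X x)%:E = \int[P]_(x in C `&` A n) (g x)%:E)%E.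

Definition Lyap (K : nat) (w : 'I_K -> R) (q : 'I_K -> R) : R :=
  2^-1 * \sum_(k < K) w k * q k ^+ 2.

End Defs.

(* Main.v *)
Require Import Defs.
From HB Require Import structures.
From mathcomp Require Import all_boot all_order all_algebra.
From mathcomp Require Import all_classical all_reals all_analysis.
From mathcomp Require Import measurable_realfun ring lra.
Import Order.TTheory GRing.Theory Num.Theory.
Import numFieldNormedType.Exports.
Local Open Scope classical_set_scope.
Local Open Scope ring_scope.
Set Implicit Arguments.
Unset Strict Implicit.
Unset Printing Implicit Defensive.

(* Write [L = (U^2 - 1) / 2] with [U >= 1].  Condition (iii) enters only through the
   unconditional bound [E (Q_k(t+1) - Q_k(t))^4 <= D].  Restricting to the event
   [U(0) <= m], which is known at every time and whose union over [m] is everything,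
   the drift inequality for [L], multiplied by [U], becomes a drift inequality for [U^3]:
     [E U(t+1)^3 <= E U(t)^3 - eta E U(t)^2 + c].
   Summing it against the weights [alpha_t = (t+1)^(-4/3)] gives
   [sum_t alpha_t E U(t)^2 < oo], so [alpha_t U(t)^2 -> 0] almost surely; in particular
   [Q_k(t) / t -> 0].  Hence the truncation [alpha_t U(t)^2 <= 1] is eventually inactive,
   while the truncated drift variables [M_t] satisfy [sum_t E M_t^2 / (t+1)^2 < oo] and
   [E[M_t | H(t)] <= 0].  A one-sided strong law, proved by a Hajek-Renyi maximal
   inequality, bounds their averages from above, and telescoping [L] turns this into
   the two limsup bounds. *)

(** Condition (iii) bounds fourth moments given [Q(t)] alone, so it says nothing about increments
    weighted by earlier events such as [U(0) <= m]. The squared increments [nu] are therefore split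
    off by Young's inequality pointwise, before integrating, so that [nu^2] carries no weight; the
    price is multiples of [U^2]. The drift pays for them: [eps] times the sum of the [|Q_k|] is at
    least [eta (U - 1)], so multiplication by [3 U] yields [- 3 eta U^2], two thirds of which absorb
    the linear and mixed terms. For [alpha_t = (t+1)^(-a)], summability needs [a > 1], while the
    mixed term [U^2 nu] in [M_t^2 / (t+1)^2], cut at [alpha_t U^2 <= 1], needs
    [(t+1)^(-4) <= alpha_t^3], that is [a <= 4/3]. Since [Q(0)] is merely finite, [L(Q(t))] may lack
    an expectation. Conditional expectations are thus localized on countable covers, and the
    argument is carried by inequalities [E[Z | H(t)] <= 0], which add up and can be integrated
    against nonnegative history-dependent weights. *)

Section Expectation.
Context {d : measure_display} {T : measurableType d} {R : realType}.
Variable P : probability T R.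
Local Notation L1 X := (P.-integrable setT (EFin \o X)).
Local Notation E X := (Rintegral P setT X).
Implicit Types X Y Z : T -> R.

(** * Integrability and linearity of expectations *)

Lemma L1_le X Y : measurable_fun setT X -> (forall x, `|X x| <= Y x) ->
  L1 Y -> L1 X.
Proof.
move=> mX XY; apply: le_integrable => //; first exact/measurable_EFinP.
by move=> x _ /=; rewrite lee_fin (le_trans (XY x)) ?ler_norm.
Qed.

Lemma L1_cst c : L1 (fun=> c).
Proof. exact: finite_measure_integrable_cst. Qed.

Lemma L1D X Y : L1 X -> L1 Y -> L1 (fun x => X x + Y x).
Proof. by move=> iX iY; apply: eq_integrable (integrableD _ iX iY). Qed.

Lemma L1Z c X : L1 X -> L1 (fun x => c * X x).
Proof. by move=> iX; apply: eq_integrable (integrableZl _ c iX). Qed.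

Lemma L1N X : L1 X -> L1 (fun x => - X x).
Proof. by move=> iX; apply: eq_integrable (integrableN iX). Qed.

Lemma L1B X Y : L1 X -> L1 Y -> L1 (fun x => X x - Y x).
Proof. by move=> iX iY; apply: L1D => //; apply: L1N. Qed.

Lemma L1_sum (I : Type) (s : seq I) (X : I -> T -> R) : (forall i, L1 (X i)) ->
  L1 (fun x => \sum_(i <- s) X i x).
Proof.
move=> iX.
have := @integrable_sum _ _ _ P setT measurableT _ s xpredT
  (fun i => EFin \o X i) (fun i _ => iX i).
by apply: eq_integrable => // x _ /=; rewrite sumEFin.
Qed.

Lemma ED X Y : L1 X -> L1 Y -> E (fun x => X x + Y x) = E X + E Y.
Proof. exact: RintegralD. Qed.

Lemma EZ c X : L1 X -> E (fun x => c * X x) = c * E X.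
Proof. exact: RintegralZl. Qed.

Lemma E_cst c : E (fun=> c) = c.
Proof.
transitivity (c * fine (P setT)); first exact: Rintegral_cst.
by rewrite probability_setT mulr1.
Qed.

Lemma Rintegral_ae_le0 D X : measurable D -> P.-integrable D (EFin \o X) ->
  {ae P, forall x, X x <= 0} -> Rintegral P D X <= 0.
Proof.
move=> mD iX X0; have mX : measurable_fun D X by move: iX => /measurable_int /measurable_EFinP.
have mXn : measurable_fun D (fun x => Num.max 0 (- X x)).
  by apply: measurable_maxr => //; apply: measurableT_comp.
have iXn : P.-integrable D (EFin \o (fun x => Num.max 0 (- X x))).
  apply: le_integrable iX => //; first exact/measurable_EFinP.
  move=> x _ /=; rewrite lee_fin ger0_norm ?le_max ?lexx// ge_max normr_ge0/=.
  by rewrite -normrN ler_norm.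
rewrite (_ : Rintegral _ _ _ = \int[P]_(x in D) (-1 * Num.max 0 (- X x))).
  rewrite RintegralZl// mulN1r oppr_le0; apply: Rintegral_ge0 => x _.
  by rewrite le_max lexx.
congr fine; apply: ae_eq_integral => //.
- exact/measurable_EFinP.
- by apply/measurable_EFinP; apply: measurable_funM.
- by apply: filterS X0 => x X0 _; rewrite max_r ?mulN1r ?opprK// oppr_ge0.
Qed.

Lemma E_le X Y : L1 X -> L1 Y -> (forall x, X x <= Y x) -> E X <= E Y.
Proof. by move=> iX iY XY; apply: le_Rintegral. Qed.

Lemma E_ge0 X : (forall x, 0 <= X x) -> 0 <= E X.
Proof. by move=> X0; apply: Rintegral_ge0. Qed.

Lemma E_sum (I : Type) (s : seq I) (X : I -> T -> R) : (forall i, L1 (X i)) ->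
  E (fun x => \sum_(i <- s) X i x) = \sum_(i <- s) E (X i).
Proof.
move=> iX; elim: s => [|i s IH].
  rewrite big_nil -[RHS](E_cst 0); apply: eq_Rintegral => x _; exact: big_nil.
rewrite big_cons -IH -ED//; last exact: L1_sum.
by apply: eq_Rintegral => x _; rewrite big_cons.
Qed.

Lemma E_fin X : L1 X -> (\int[P]_x (X x)%:E)%E = (E X)%:E.
Proof. by move=> iX; rewrite fineK//; apply: integrable_fin_num. Qed.

End Expectation.

(** * Calculus of localized conditional inequalities *)

Section ConditionalDrift.
Context {d : measure_display} {T : measurableType d} {R : realType}.
Variable P : probability T R.
Variable gen : set (set T).
Hypothesis gen_measurable : <<s gen >> `<=` measurable.
Local Notation L1 X := (P.-integrable setT (EFin \o X)).
Local Notation E X := (Rintegral P setT X).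
Local Notation G := (g_sigma_algebraType gen).
Implicit Types (X Y Z h : T -> R) (A C : set T).

(* [E[Z | G] <= 0] in the localized sense of [is_cond_exp]. *)
Definition cond_nonpos Z := measurable_fun setT Z /\
  exists A : nat -> set T, (forall n, <<s gen >> (A n)) /\ \bigcup_n A n = setT /\
    forall n, P.-integrable (A n) (EFin \o Z) /\
      forall C, <<s gen >> C -> Rintegral P (C `&` A n) Z <= 0.

Lemma adaptedW X : measurable_fun setT (X : G -> R) -> measurable_fun setT X.
Proof. by move=> mX _ B mB; apply: gen_measurable; apply: mX. Qed.

Lemma sigmaI A C : <<s gen >> A -> <<s gen >> C -> <<s gen >> (A `&` C).
Proof. exact: (@measurableI _ G). Qed.

(** Common refinement of two countable covers, indexed by codes of pairs; a number coding no pair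
    gives the empty set, where every integral condition is trivial. *)
Definition cover_meet (A C : nat -> set T) k : set T :=
  if unpickle k is Some (i, j) then A i `&` C j else set0.

Lemma cover_meetP (A C : nat -> set T) :
  \bigcup_n A n = setT -> \bigcup_n C n = setT ->
  \bigcup_n cover_meet A C n = setT.
Proof.
move=> /seteqP[_ cA] /seteqP[_ cC]; apply/seteqP; split=> // x _.
have [i _ Ai] := cA x I; have [j _ Cj] := cC x I.
by exists (pickle (i, j)) => //; rewrite /cover_meet pickleK.
Qed.

Lemma cover_meet_sigma (A C : nat -> set T) :
  (forall n, <<s gen >> (A n)) -> (forall n, <<s gen >> (C n)) ->
  forall k, <<s gen >> (cover_meet A C k).
Proof.
move=> sA sC k; rewrite /cover_meet; case: unpickle => [[i j]|]; first exact: sigmaI.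
exact: (@measurable0 _ G).
Qed.

Lemma integrable_sub A C Z : <<s gen >> A -> <<s gen >> C -> C `<=` A ->
  P.-integrable A (EFin \o Z) -> P.-integrable C (EFin \o Z).
Proof. by move=> sA sC CA; apply: integrableS => //; apply: gen_measurable. Qed.

Lemma cond_nonposD X Y : cond_nonpos X -> cond_nonpos Y ->
  cond_nonpos (fun x => X x + Y x).
Proof.
move=> [mX [A [sA [cA iA]]]] [mY [C [sC [cC iC]]]]; split.
  exact: measurable_funD.
exists (cover_meet A C); split; first exact: cover_meet_sigma.
split=> [|n]; first exact: cover_meetP.
rewrite /cover_meet; case: unpickle => [[i j]|]; last first.
  split; first exact: integrable_set0.
  by move=> D sD; rewrite setI0 Rintegral_set0.
have [iXi Xi] := iA i; have [iYj Yj] := iC j.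
have sij := sigmaI (sA i) (sC j).
have iX : P.-integrable (A i `&` C j) (EFin \o X) by apply: integrable_sub iXi.
have iY : P.-integrable (A i `&` C j) (EFin \o Y) by apply: integrable_sub iYj.
split.
  apply: eq_integrable (integrableD _ iX iY) => //; exact: gen_measurable.
move=> D sD; have sDij := sigmaI sD sij.
rewrite RintegralD; [|exact: gen_measurable|exact: integrable_sub iX|exact: integrable_sub iY].
rewrite -[leRHS]addr0 lerD//.
  (* The cover set of the other variable is moved into the test set. *)
  by have := Xi _ (sigmaI sD (sC j)); rewrite -setIA (setIC (C j)).
by have := Yj _ (sigmaI sD (sA i)); rewrite -setIA.
Qed.

Lemma cond_nonposZ c X : 0 <= c -> cond_nonpos X -> cond_nonpos (fun x => c * X x).
Proof.
move=> c0 [mX [A [sA [cA iA]]]]; split; first exact: measurable_funM.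
exists A; split=> //; split=> // n; have [iXn Xn] := iA n.
split; first by apply: eq_integrable (integrableZl _ c iXn) => //; exact: gen_measurable.
move=> C sC; have sCA := sigmaI sC (sA n).
rewrite RintegralZl; [|exact: gen_measurable|exact: integrable_sub iXn].
by rewrite mulr_ge0_le0// Xn.
Qed.

(** The level sets [|h| <= n] lie in the sigma-algebra because [h] is measurable for it; as a cover
    they supply the integrability that [h] may lack globally. *)
Lemma cond_nonpos_adapted h : measurable_fun setT (h : G -> R) ->
  {ae P, forall x, h x <= 0} -> cond_nonpos h.
Proof.
move=> mh h0; split; first exact: adaptedW.
exists (fun n : nat => [set x | `|h x| <= n%:R]).
have sA n : <<s gen >> [set x | `|h x| <= n%:R].
  rewrite -[X in <<s _ >> X]setTI.
  apply: (@measurable_fun_le _ G R setT (fun x => `|h x|) (fun=> n%:R)) => //.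
  exact: measurableT_comp.
split=> //; split.
  apply/seteqP; split=> // x _; exists (Num.bound `|h x|) => //=.
  by rewrite ltW// archi_boundP.
have iA n : P.-integrable [set x | `|h x| <= n%:R] (EFin \o h).
  apply: measurable_bounded_integrable => //.
  - exact: gen_measurable.
  - rewrite ltey_eq; apply/orP; left; apply: fin_num_measure; exact: gen_measurable.
  - by apply: measurable_funTS; exact: adaptedW.
  - exists n%:R; split; first exact: num_real.
    by move=> M nM x /= hn; rewrite (le_trans hn) ?ltW.
move=> n; split; first exact: iA.
move=> C sC; have sCA := sigmaI sC (sA n).
apply: Rintegral_ae_le0 => //; first exact: gen_measurable.
by apply: (integrable_sub (sA n)) (iA n).
Qed.

(** Both signs are kept: the first transfers upper bounds on [g] to [X], the second lower bounds, as
    for the penalty and [pmin]. *)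
Lemma cond_nonpos_cond_exp X g : measurable_fun setT X ->
  is_cond_exp P <<s gen >> X g ->
  cond_nonpos (fun x => X x - g x) /\ cond_nonpos (fun x => g x - X x).
Proof.
move=> mX [mg [A [sA [cA iA]]]].
have mg' : measurable_fun setT g.
  by move=> _ B mB; rewrite setTI; apply: gen_measurable; exact: mg.
have H n C : <<s gen >> C -> Rintegral P (C `&` A n) X = Rintegral P (C `&` A n) g.
  by move=> sC; have [_ [_ e]] := iA n; rewrite /Rintegral e.
have main Y Z : measurable_fun setT Y -> measurable_fun setT Z ->
    (forall n, P.-integrable (A n) (EFin \o Y)) ->
    (forall n, P.-integrable (A n) (EFin \o Z)) ->
    (forall n C, <<s gen >> C ->
      Rintegral P (C `&` A n) Y = Rintegral P (C `&` A n) Z) ->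
    cond_nonpos (fun x => Y x - Z x).
  move=> mY mZ iY iZ YZ; split; first exact: measurable_funB.
  exists A; split=> //; split=> // n; split.
    apply: eq_integrable (integrableB _ (iY n) (iZ n)) => //; exact: gen_measurable.
  move=> C sC; have sCA := sigmaI sC (sA n).
  rewrite RintegralB ?YZ ?subrr//.
  - exact: gen_measurable.
  - exact: integrable_sub (iY n).
  - exact: integrable_sub (iZ n).
split; apply: main => // n; have [iX [ig _]] := iA n; by [|move=> C sC; rewrite H].
Qed.

End ConditionalDrift.

(** * Integrating a conditional inequality against nonnegative weights *)

Section ConditionalDriftIntegral.
Context {d : measure_display} {T : measurableType d} {R : realType}.
Variable P : probability T R.
Variable gen : set (set T).
Hypothesis gen_measurable : <<s gen >> `<=` measurable.
Local Notation L1 X := (P.-integrable setT (EFin \o X)).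
Local Notation E X := (Rintegral P setT X).
Local Notation G := (g_sigma_algebraType gen).
Implicit Types (X Y Z h xi : T -> R) (A C : set T).

Lemma le_meas_sigma xi c : measurable_fun setT (xi : G -> R) ->
  <<s gen >> [set x | c <= xi x] /\ <<s gen >> [set x | xi x <= c].
Proof.
move=> mxi; split.
  by rewrite -[X in <<s _ >> X]setTI; exact: (@measurable_fun_le _ G R setT (fun=> c) xi).
by rewrite -[X in <<s _ >> X]setTI; exact: (@measurable_fun_le _ G R setT xi (fun=> c)).
Qed.

Lemma integrable_bounded_mul D Z xi (M : R) : measurable D -> measurable_fun D xi ->
  (forall x, D x -> `|xi x| <= M) -> P.-integrable D (EFin \o Z) ->
  P.-integrable D (EFin \o (fun x => xi x * Z x)).
Proof.
move=> mD mxi xiM iZ.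
have mZ : measurable_fun D Z by move: iZ => /measurable_int /measurable_EFinP.
have := integrableZl mD M iZ; apply: le_integrable => //.
  by apply/measurable_EFinP; apply: measurable_funM.
move=> x Dx /=; rewrite lee_fin !normrM ler_wpM2r//.
by rewrite (le_trans (xiM x Dx)) ?ler_norm.
Qed.

(* Rounds [y <= n h] down to a multiple of [h] as a sum of indicators, which reduces
   weighted integrals to integrals over sets of the sigma-algebra. *)
Definition staircase (h : R) n (y : R) : R := \sum_(k < n) h * (k.+1%:R * h <= y)%R%:R.

Lemma staircaseP (h y : R) n : 0 < h ->
  (n%:R * h <= y -> staircase h n y = n%:R * h) /\
  (0 <= y -> y < n%:R * h -> 0 <= y - staircase h n y <= h).
Proof.
move=> h0; rewrite /staircase; elim: n => [|n [IH1 IH2]].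
  by split; rewrite ?big_ord0 mul0r// => y0 y1; lra.
rewrite big_ord_recr/=.
have e : n.+1%:R * h = n%:R * h + h by rewrite -natr1 mulrDl mul1r.
case: (lerP (n.+1%:R * h) y) => [ny|yn].
  split=> // _; rewrite IH1 ?mulr1//; lra.
split=> // y0 _; rewrite mulr0 addr0.
case: (lerP (n%:R * h) y) => [ny|yn']; last exact: IH2.
rewrite IH1//; lra.
Qed.

(** Each level set of [xi] lies in the sigma-algebra, so the weighted integral is a nonnegative
    combination of nonpositive ones. *)
Lemma staircase_integral_le0 C Z xi (h : R) n : <<s gen >> C -> 0 < h ->
  measurable_fun setT (xi : G -> R) -> P.-integrable C (EFin \o Z) ->
  (forall D, <<s gen >> D -> Rintegral P (D `&` C) Z <= 0) ->
  P.-integrable C (EFin \o (fun x => staircase h n (xi x) * Z x)) /\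
  \int[P]_(x in C) (staircase h n (xi x) * Z x) <= 0.
Proof.
move=> sC h0 mxi iZ Z0; have mC : measurable C by exact: gen_measurable.
rewrite /staircase; elim: n => [|n [IH1 IH2]].
  split; last first.
    under eq_Rintegral do rewrite big_ord0 mul0r.
    by rewrite Rintegral_cst// mul0r.
  have := integrable0 P C.
  by apply: eq_integrable => // x _ /=; rewrite big_ord0 mul0r.
pose D := [set x | n.+1%:R * h <= xi x].
have sD : <<s gen >> D by case: (le_meas_sigma (n.+1%:R * h) mxi).
have mD : measurable D by exact: gen_measurable.
have DE x : \1_D x = (n.+1%:R * h <= xi x)%R%:R :> R.
  rewrite indicE (_ : (x \in D) = (n.+1%:R * h <= xi x)%R)//.
  by apply/idP/idP; rewrite inE.
have iZD : P.-integrable C (EFin \o (fun x => \1_D x * Z x)).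
  apply: (integrable_bounded_mul (M := 1)) => //.
  move=> x _; rewrite indicE; case: (_ \in _); rewrite ?normr1 ?normr0//.
have ihZD : P.-integrable C (EFin \o (fun x => h * (\1_D x * Z x))).
  by apply: eq_integrable (integrableZl _ h iZD).
have e x : (\sum_(k < n.+1) h * (k.+1%:R * h <= xi x)%R%:R) * Z x =
    (\sum_(k < n) h * (k.+1%:R * h <= xi x)%R%:R) * Z x + h * (\1_D x * Z x).
  by rewrite big_ord_recr/= mulrDl DE mulrA.
split.
  by apply: eq_integrable (integrableD _ IH1 ihZD) => // x _ /=; rewrite e.
under eq_Rintegral do rewrite e.
rewrite RintegralD// -[leRHS]addr0 lerD// RintegralZl// mulr_ge0_le0 ?(ltW h0)//.
have := Z0 D sD; rewrite Rintegral_mkcondl patch_indic.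
by under eq_Rintegral do rewrite /= mulrC.
Qed.

(** A staircase of mesh [h] is within [h] of [xi] on [C], so the integral is at most [h] times that
    of [|Z|], with [h] arbitrary. *)
Lemma cond_nonpos_bounded C Z xi (N : R) : <<s gen >> C ->
  measurable_fun setT (xi : G -> R) -> P.-integrable C (EFin \o Z) ->
  (forall D, <<s gen >> D -> Rintegral P (D `&` C) Z <= 0) ->
  (forall x, C x -> 0 <= xi x <= N) ->
  \int[P]_(x in C) (xi x * Z x) <= 0.
Proof.
move=> sC mxi iZ Z0 xiN; have mC : measurable C by exact: gen_measurable.
have mxiC : measurable_fun C xi.
  by apply: measurable_funTS; exact: (adaptedW gen_measurable).
have ixi : P.-integrable C (EFin \o (fun x => xi x * Z x)).
  apply: (integrable_bounded_mul (M := N)) => // x Cx.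
  by case/andP: (xiN x Cx) => a b; rewrite ger0_norm.
pose I := \int[P]_(x in C) `|Z x|.
have I0 : 0 <= I by apply: Rintegral_ge0.
have iaZ : P.-integrable C (EFin \o (fun x => `|Z x|)) by exact: integrable_norm.
suff H (h : R) : 0 < h -> \int[P]_(x in C) (xi x * Z x) <= h * I.
  rewrite leNgt; apply/negP => lt0.
  set J := Rintegral _ _ _ in lt0 H.
  (* A positive value [J] is refuted by this mesh, for which [h * I < J]. *)
  have := H (J / (I + 1)) (divr_gt0 lt0 (ltr_wpDl I0 ltr01)).
  rewrite mulrAC ler_pdivlMr; last lra.
  rewrite ler_pM2l//; lra.
move=> h0.
have [n Nn] : exists n : nat, N < n%:R * h.
  have [N0|N0] := ltP N 0; first by exists 0; rewrite mul0r.
  exists (Num.bound (N / h)); rewrite -ltr_pdivrMr// archi_boundP//.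
  by rewrite divr_ge0// ltW.
have [iS s0] := staircase_integral_le0 n sC h0 mxi iZ Z0.
rewrite (_ : Rintegral _ _ _ = \int[P]_(x in C)
   ((xi x * Z x - staircase h n (xi x) * Z x) + staircase h n (xi x) * Z x)); last first.
  by apply: eq_Rintegral => x _; rewrite subrK.
have id : P.-integrable C (EFin \o (fun x => xi x * Z x - staircase h n (xi x) * Z x)).
  by apply: eq_integrable (integrableB _ ixi iS).
rewrite RintegralD// -[leRHS]addr0 lerD// -RintegralZl//.
apply: le_Rintegral => //.
  by apply: eq_integrable (integrableZl _ h iaZ).
move=> x Cx; rewrite -mulrBl (le_trans (ler_norm _))// normrM ler_wpM2r//.
have /andP[x0 xN] := xiN x Cx.
have [_ /(_ x0 (le_lt_trans xN Nn)) /andP[a b]] := staircaseP (xi x) n h0.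
by rewrite ger0_norm.
Qed.

(** The cover of [Z] is refined by the level sets of [xi] and made disjoint; on each piece [Z] is
    integrable and [xi] bounded, and integrability of the product allows summing over the pieces. *)
Lemma cond_nonpos_mul Z xi : cond_nonpos P gen Z ->
  measurable_fun setT (xi : G -> R) -> (forall x, 0 <= xi x) ->
  L1 (fun x => xi x * Z x) -> E (fun x => xi x * Z x) <= 0.
Proof.
move=> [mZ [A [sA [cA iA]]]] mxi xi0 ixi.
pose C (n : nat) := [set x | xi x <= n%:R].
have sC n : <<s gen >> (C n) by case: (le_meas_sigma n%:R mxi).
have cC : \bigcup_n C n = setT.
  apply/seteqP; split=> // x _; exists (Num.bound (xi x)) => //=.
  by apply: ltW; exact: archi_boundP.
pose F := seqDU (cover_meet A C).
have sF n : <<s gen >> (F n).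
  by apply: (@seqDU_measurable _ G) => k; exact: cover_meet_sigma.
have mF n : measurable (F n) by exact: gen_measurable.
have F1 : \bigcup_n F n = setT.
  by rewrite -seqDU_bigcup_eq; exact: cover_meetP.
have FC n : F n `<=` cover_meet A C n by move=> x [].
rewrite /Rintegral -fine0; apply: fine_le => //; first exact: integrable_fin_num.
rewrite -F1 integral_bigcup ?F1//; last exact: trivIset_seqDU.
apply: npeseries_le0 => n _ _.
have iF : P.-integrable (F n) (EFin \o (fun x => xi x * Z x)).
  exact: integrableS ixi.
rewrite -[X in (X <= _)%E]fineK ?integrable_fin_num// lee_fin.
move: (FC n); rewrite /cover_meet; case: unpickle => [[i j]|] FAC; last first.
  rewrite (_ : F n = set0); last by apply/seteqP; split.
  by rewrite integral_set0.
have [iZ Z0] := iA i.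
apply: (@cond_nonpos_bounded (F n) Z xi j%:R) => //.
- by apply: (integrable_sub gen_measurable (sA i)) iZ => // x /FAC[].
- move=> D sD; have := Z0 _ (sigmaI sD (sF n)); rewrite -setIA.
  by rewrite (_ : F n `&` A i = F n)//; apply/setIidPl => x /FAC[].
- by move=> x /FAC[_ /= xj]; rewrite xi0.
Qed.

(** Integrability is a conclusion: since [X >= 0], the bounds on the disjoint pieces of the cover
    add up in the extended reals to [c] times the total mass 1. *)
Lemma cond_bound_expectation X c : measurable_fun setT X -> (forall x, 0 <= X x) ->
  0 <= c -> cond_nonpos P gen (fun x => X x - c) -> L1 X /\ E X <= c.
Proof.
move=> mX X0 c0 [mZ [A [sA [cA iA]]]].
pose F := seqDU A.
have sF n : <<s gen >> (F n) by apply: (@seqDU_measurable _ G) => k; exact: sA.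
have mF n : measurable (F n) by exact: gen_measurable.
have F1 : \bigcup_n F n = setT by rewrite -seqDU_bigcup_eq.
have FA n : F n `<=` A n by move=> x [].
have le_int : (\int[P]_x (X x)%:E <= c%:E)%E.
  have -> : c%:E = (\int[P]_x c%:E)%E.
    transitivity (c%:E * P setT)%E; first by rewrite probability_setT mule1.
    by apply/esym; exact: integral_cst.
  have tF : trivIset setT F by exact: trivIset_seqDU.
  have mEX : measurable_fun setT (EFin \o X) by exact/measurable_EFinP.
  rewrite -F1 !ge0_integral_bigcup ?F1//; last by move=> x _; rewrite lee_fin.
  apply: lee_nneseries => [n _ _|n _].
    by apply: integral_ge0 => x _; rewrite lee_fin.
  have iF : P.-integrable (F n) (EFin \o (fun x => X x - c)).
    by apply: (integrable_sub gen_measurable (sA n)) (iA n).1.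
  have ic : P.-integrable (F n) (EFin \o (fun=> c)).
    by apply: integrableS (L1_cst P c).
  have iX : P.-integrable (F n) (EFin \o X).
    by apply: eq_integrable (integrableD _ iF ic) => // x _ /=; rewrite -EFinD subrK.
  have := (iA n).2 _ (sF n).
  rewrite (_ : F n `&` A n = F n); last by apply/setIidPl => x /FA.
  rewrite RintegralB// subr_le0 => le1.
  rewrite -[leLHS]fineK ?integrable_fin_num//.
  by rewrite -[leRHS]fineK ?integrable_fin_num// lee_fin.
have iX : L1 X.
  apply/integrableP; split; first exact/measurable_EFinP.
  under eq_integral do rewrite /= ger0_norm//.
  exact: le_lt_trans le_int (ltry c).
by split=> //; rewrite -lee_fin -(E_fin iX).
Qed.

End ConditionalDriftIntegral.

(** * Nonnegative series with bounded partial sums *)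

Section BoundedSeries.
Context {R : realType}.
Implicit Type e : nat -> R.

Lemma ge0_series_cvg e c : (forall t, 0 <= e t) ->
  (forall n, \sum_(t < n) e t <= c) -> cvgn (series e).
Proof.
move=> e0 ec; apply: nondecreasing_is_cvgn.
  apply/nondecreasing_seqP => n.
  by rewrite !seriesEord/= big_ord_recr/= lerDl.
by exists c => _ [n _ <-]; rewrite seriesEord; exact: ec.
Qed.

Lemma ge0_series_eventually_le e c (r : R) : (forall t, 0 <= e t) ->
  (forall n, \sum_(t < n) e t <= c) -> 0 < r -> exists N, forall t, (N <= t)%N -> e t <= r.
Proof.
move=> e0 ec r0; have /cvg_series_cvg_0 /cvgrPdist_le := ge0_series_cvg e0 ec.
move=> /(_ _ r0)[N _ H]; exists N => t Nt.
by have := H t Nt; rewrite /= sub0r normrN ger0_norm.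
Qed.

(* Kronecker-type bound: the weight [(t+1)^2/(max(t,m)+1)^2] is small for fixed [t]
   and at most [1], so it suffices to cut the series where its tail is small. *)
Lemma delayed_weight_series e c (r : R) : (forall t, 0 <= e t) ->
  (forall n, \sum_(t < n) e t <= c) -> 0 < r ->
  exists m : nat, forall n,
    \sum_(t < n) ((maxn t m).+1%:R ^+ 2)^-1 * (t.+1%:R ^+ 2 * e t) <= r.
Proof.
move=> e0 ec r0; have cv := ge0_series_cvg e0 ec.
pose l := limn (series e).
have sl n : series e n <= l.
  apply: nondecreasing_cvgn_le => //.
  by apply/nondecreasing_seqP => k; rewrite !seriesEord/= big_ord_recr/= lerDl.
have [N HN] : exists N, l - r / 2 <= series e N.
  have /cvgrPdist_le/(_ (r / 2)) : series e @ \oo --> l by [].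
  rewrite divr_gt0// => /(_ isT)[N _ H]; exists N.
  by have := H N (leqnn N); rewrite /= ger0_norm ?subr_ge0//; lra.
have c0 : 0 <= c by have := ec 0; rewrite big_ord0.
(* With [m = N * q], each weight in the head [t < N] is at most [1 / q], so the head contributes at
   most [c / q <= r / 2]; the tail is at most [r / 2] by the choice of [N]. *)
have [q q0 Hq] : exists2 q : nat, (0 < q)%N & c <= q%:R * (r / 2).
  exists (Num.bound (c / (r / 2))).+1 => //.
  rewrite -ler_pdivrMr ?divr_gt0// (le_trans (ltW (archi_boundP _)))//.
    by rewrite divr_ge0// ltW// divr_gt0.
  by rewrite ler_nat.
exists (N * q)%N => n.
set b := fun t : nat => ((maxn t (N * q)).+1%:R ^+ 2)^-1 * (t.+1%:R ^+ 2 * e t).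
have b0 t : 0 <= b t.
  by rewrite mulr_ge0// ?invr_ge0 ?exprn_ge0// mulr_ge0// exprn_ge0.
have b1 t : b t <= e t.
  rewrite /b mulrA ler_piMl// mulrC ler_pdivrMr ?exprn_gt0// mul1r.
  by rewrite ler_pXn2r ?nnegrE// ler_nat ltnS leq_maxl.
have b2 t : (t < N)%N -> b t <= q%:R^-1 * e t.
  move=> tN; rewrite /b mulrA ler_wpM2r// -exprVn -exprMn.
  set x := _^-1 * _.
  have x0 : 0 <= x by rewrite mulr_ge0// invr_ge0.
  have xq : x <= q%:R^-1.
    rewrite /x mulrC ler_pdivrMr// mulrC ler_pdivlMr ?ltr0n//.
    rewrite -natrM ler_nat (leq_trans _ (leqnSn _))// (leq_trans _ (leq_maxr _ _))//.
    by rewrite leq_mul2r tN orbT.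
  apply: (le_trans _ xq); rewrite expr2 ler_piMl//.
  by apply: (le_trans xq); rewrite invf_le1 ?ltr0n// ler1n.
suff H k : \sum_(t < N + k) b t <= r.
  have [nN|Nn] := leqP n N; last by rewrite -(subnKC (ltnW Nn)).
  apply: le_trans (H 0); rewrite addn0 -!(big_mkord xpredT b).
  by rewrite (big_cat_nat _ nN)//= lerDl sumr_ge0.
have HNk : \sum_(t < N) b t <= r / 2.
  apply: (le_trans (ler_sum _ (fun (t : 'I_N) _ => b2 t (ltn_ord t)))).
  rewrite -mulr_sumr mulrC ler_pdivrMr ?ltr0n// mulrC.
  exact: le_trans (ec N) _.
have Hk : \sum_(t < N + k) b t <= \sum_(t < N) b t + (series e (N + k)%N - series e N).
  rewrite !seriesEord/=; elim: k => [|k IH]; first by rewrite addn0 subrr addr0.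
  by rewrite addnS !big_ord_recr/=; have := b1 (N + k)%N; lra.
have := sl (N + k)%N; lra.
Qed.

End BoundedSeries.

(** * Almost sure convergence from summable expectations *)

Section AlmostSure.
Context {d : measure_display} {T : measurableType d} {R : realType}.
Variable P : probability T R.
Local Notation L1 X := (P.-integrable setT (EFin \o X)).
Local Notation E X := (Rintegral P setT X).

Lemma E_indic (A : set T) : measurable A ->
  L1 (\1_A : T -> R) /\ (E (\1_A : T -> R))%:E = P A.
Proof.
move=> mA; have i1 : L1 (\1_A : T -> R).
  apply: (L1_le (Y := fun=> 1)); last exact: L1_cst.
    by apply: measurable_indic.
  by move=> x; rewrite indicE; case: (_ \in _); rewrite ?normr1 ?normr0.
split=> //; rewrite -(E_fin i1).
by rewrite integral_indic// setIT.
Qed.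

(** By monotone convergence the sum of the [X t] has a finite integral, hence is finite almost
    everywhere, and its terms tend to 0. *)
Lemma ae_series_eventually_le (X : nat -> T -> R) c :
  (forall t x, 0 <= X t x) -> (forall t, L1 (X t)) ->
  (forall n, \sum_(t < n) E (X t) <= c) ->
  {ae P, forall x, forall r, 0 < r -> exists N, forall t, (N <= t)%N -> X t x <= r}.
Proof.
move=> X0 iX Xc.
pose f x := (\sum_(0 <= t <oo) (X t x)%:E)%E.
have mX t : measurable_fun setT (EFin \o X t) by exact: measurable_int (iX t).
have f0 x : (0 <= f x)%E by apply: nneseries_ge0 => t _ _; rewrite lee_fin.
have intf : (\int[P]_x f x <= c%:E)%E.
  rewrite integral_nneseries//; last by move=> t x _; rewrite lee_fin.
  apply: lime_le.
    by apply: is_cvg_nneseries => t _ _; apply: integral_ge0 => x _; rewrite lee_fin.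
  apply: nearW => n; under eq_bigr do rewrite E_fin//.
  by rewrite sumEFin lee_fin big_mkord.
have mf : measurable_fun setT f.
  apply: (ge0_emeasurable_sum (h := fun t x => (X t x)%:E) (P := xpredT)) => [t x _ _|t _].
    by rewrite lee_fin.
  exact: mX.
have iF : P.-integrable setT f.
  apply/integrableP; split; first exact: mf.
  apply: le_lt_trans (ltry c); apply: le_trans intf; rewrite le_eqVlt; apply/orP; left.
  by apply/eqP/eq_integral => x _; rewrite gee0_abs.
have := integrable_ae measurableT iF; apply: filterS => x /(_ I) fx r r0.
apply: (@ge0_series_eventually_le _ _ (fine (f x))) => // n.
rewrite -lee_fin fineK// -sumEFin -(big_mkord xpredT (fun t => (X t x)%:E)).
by apply: nneseries_lim_ge => t _ _; rewrite lee_fin.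
Qed.

End AlmostSure.

(** * One-sided strong law for supermartingale differences *)

Section StrongLaw.
Context {d : measure_display} {T : measurableType d} {R : realType}.
Variable P : probability T R.
Local Notation L1 X := (P.-integrable setT (EFin \o X)).
Local Notation E X := (Rintegral P setT X).

Lemma L1_sqrD (X Y : T -> R) : measurable_fun setT X -> measurable_fun setT Y ->
  L1 (fun x => X x ^+ 2) -> L1 (fun x => Y x ^+ 2) -> L1 (fun x => (X x + Y x) ^+ 2).
Proof.
move=> mX mY iX iY; apply: (L1_le (Y := fun x => 2 * X x ^+ 2 + 2 * Y x ^+ 2)).
- by apply: measurable_funX; apply: measurable_funD.
- by move=> x; rewrite ger0_norm ?sqr_ge0//; have := sqr_ge0 (X x - Y x); nra.
- by apply: L1D; apply: L1Z.
Qed.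

Lemma L1M (X Y : T -> R) : measurable_fun setT X -> measurable_fun setT Y ->
  L1 (fun x => X x ^+ 2) -> L1 (fun x => Y x ^+ 2) -> L1 (fun x => X x * Y x).
Proof.
move=> mX mY iX iY; apply: (L1_le (Y := fun x => X x ^+ 2 + Y x ^+ 2)).
- by apply: measurable_funM.
- by move=> x; rewrite ler_norml; have := sqr_ge0 (X x - Y x);
    have := sqr_ge0 (X x + Y x); nra.
- exact: L1D.
Qed.

Variable F : nat -> set (set T).
Hypothesis F_measurable : forall t, <<s F t >> `<=` measurable.
Hypothesis F_mono : forall t, <<s F t >> `<=` <<s F t.+1 >>.
Local Notation G t := (g_sigma_algebraType (F t)).

Lemma adaptedS t (X : T -> R) : measurable_fun setT (X : G t -> R) ->
  measurable_fun setT (X : G t.+1 -> R).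
Proof. by move=> mX mT B mB; apply: F_mono; exact: mX. Qed.

Lemma adapted_ler t (X : T -> R) c : measurable_fun setT (X : G t -> R) ->
  measurable_fun setT ((fun x => (X x <= c)%R%:R) : G t -> R).
Proof.
move=> mX.
rewrite (_ : (fun x => (X x <= c)%R%:R) = (\1_[set x | X x <= c] : G t -> R)).
  by apply: measurable_indic; have [] := le_meas_sigma c mX.
apply/funext => x; rewrite indicE (_ : (x \in _) = (X x <= c)%R)//.
by apply/idP/idP; rewrite inE.
Qed.

Variable M : nat -> T -> R.
Hypothesis M_adapted : forall t, measurable_fun setT (M t : G t.+1 -> R).
Hypothesis M_sqr : forall t, L1 (fun x => M t x ^+ 2).
Hypothesis M_drift : forall t (xi : T -> R), measurable_fun setT (xi : G t -> R) ->
  (forall x, 0 <= xi x) -> L1 (fun x => xi x * M t x) -> E (fun x => xi x * M t x) <= 0.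
Variable c : R.
Hypothesis M_sum : forall n, \sum_(t < n) (t.+1%:R ^+ 2)^-1 * E (fun x => M t x ^+ 2) <= c.

Let S t x := \sum_(s < t) M s x.

Let mM t : measurable_fun setT (M t).
Proof. exact: (adaptedW (F_measurable (t := t.+1))) (@M_adapted t). Qed.

Let S_adapted t : measurable_fun setT (S t : G t -> R).
Proof.
elim: t => [|t IH]; rewrite /S.
  rewrite (_ : (fun x => _) = fun=> 0); last by apply/funext => x; rewrite big_ord0.
  exact: measurable_cst.
rewrite (_ : (fun x => _) = fun x => S t x + M t x); last first.
  by apply/funext => x; rewrite big_ord_recr.
by apply: measurable_funD => //; exact: adaptedS.
Qed.

Let mS t : measurable_fun setT (S t).
Proof. exact: (adaptedW (F_measurable (t := t))) (@S_adapted t). Qed.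

Let S_sqr t : L1 (fun x => S t x ^+ 2).
Proof.
elim: t => [|t IH]; rewrite /S.
  rewrite (_ : (fun x => _) = fun=> 0); first exact: L1_cst.
  by apply/funext => x; rewrite big_ord0 expr0n.
rewrite (_ : (fun x => _) = fun x => (S t x + M t x) ^+ 2); first exact: L1_sqrD.
by apply/funext => x; rewrite big_ord_recr.
Qed.

(** * Hajek-Renyi inequality through a stopped quadratic potential *)

Section Hitting.
Variables (eps : R) (m : nat).
Hypothesis eps0 : 0 < eps.

(* Indicator that [S s <= eps (s + 1)] for all [m <= s < t]. *)
Fixpoint below t x : R := if t is t'.+1 then
  below t' x * (if (m <= t')%N then (S t' x <= eps * t'.+1%:R)%R%:R else 1) else 1.

(** Frozen up to time [m], because the barrier is tested only from [m] on; for [t >= m], crossing it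
    means [b t * Sp t x ^+ 2 > eps ^+ 2]. *)
Let b t : R := ((maxn t m).+1%:R ^+ 2)^-1.

(** The positive part makes the weight of [M t] in [V_step] nonnegative, as [M_drift] requires. *)
Let Sp t x := Num.max 0 (S t x).

(* Potential of the walk stopped, at value [eps^2], when it first exceeds the barrier. *)
Let V t x := eps ^+ 2 * (1 - below t x) + below t x * (b t * Sp t x ^+ 2).

Lemma below01 t x : below t x = 0 \/ below t x = 1.
Proof.
elim: t => [|t IH] /=; first by right.
case: IH => ->; first by left; rewrite mul0r.
rewrite mul1r; case: ifP => _; last by right.
by case: (_ <= _); [right|left].
Qed.

Let b_ge0 t : 0 <= b t. Proof. by rewrite invr_ge0 exprn_ge0. Qed.

Let b_decr t : b t.+1 <= b t.
Proof.
rewrite /b lef_pV2 ?posrE ?exprn_gt0// ler_pXn2r ?nnegrE// ler_nat ltnS.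
by rewrite geq_max leq_maxr andbT (leq_trans (leqnSn t))// leq_maxl.
Qed.

Let V_step t x : V t.+1 x <= V t x + (2 * b t * below t.+1 x * Sp t x) * M t x +
  b t * M t x ^+ 2.
Proof.
have b0 := b_ge0 t; have b1 := b_ge0 t.+1.
have MM : 0 <= b t * M t x ^+ 2 by rewrite mulr_ge0// sqr_ge0.
rewrite /V /=; case: (below01 t x) => ->; first by rewrite !mul0r !(mulr0, mul0r); lra.
rewrite mul1r subrr mulr0 add0r mul1r.
set v := (if _ then _ else _); have [v0|v1] : (v = 0 /\ eps ^+ 2 <= b t * Sp t x ^+ 2) \/ v = 1.
- rewrite /v; case: ifP => mt; last by right.
  case: (lerP (S t x) (eps * t.+1%:R)) => h; first by right.
  left; split=> //; have t0 : 0 < t.+1%:R :> R by rewrite ltr0n.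
  have Spos : 0 < S t x by apply: lt_trans h; exact: mulr_gt0.
  rewrite /b (maxn_idPl mt) /Sp max_r ?(ltW Spos)// mulrC ler_pdivlMr ?exprn_gt0//.
  by rewrite -exprMn ler_pXn2r ?nnegrE ?ltW// mulr_gt0.
- by case: v0 => -> h; rewrite subr0 mulr1 !(mul0r, mulr0) !addr0; lra.
rewrite v1 subrr mulr0 add0r mul1r mulr1.
have Sp0 : 0 <= Sp t x by rewrite /Sp le_max lexx.
have SSp : S t x <= Sp t x by rewrite /Sp le_max lexx orbT.
rewrite -/(Sp t x) [Sp t.+1 x]/Sp.
have -> : S t.+1 x = S t x + M t x by rewrite /S big_ord_recr.
have H : Num.max 0 (S t x + M t x) ^+ 2 <= (Sp t x + M t x) ^+ 2.
  by case: (lerP 0 (S t x + M t x)) => h; [nra|rewrite expr0n sqr_ge0].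
have : b t.+1 * Num.max 0 (S t x + M t x) ^+ 2 <= b t * (Sp t x + M t x) ^+ 2.
  by apply: ler_pM => //; exact: sqr_ge0.
by rewrite sqrrD !mulrDr; lra.
Qed.

Lemma below_adapted t : measurable_fun setT (below t.+1 : G t -> R).
Proof.
have aux k : measurable_fun setT
    ((fun x => if (m <= k)%N then (S k x <= eps * k.+1%:R)%R%:R else 1) : G k -> R).
  by case: (m <= k)%N; [exact: adapted_ler|exact: measurable_cst].
elim: t => [|t IH] /=.
  by apply: measurable_funM.
by apply: measurable_funM; [exact: adaptedS IH|exact: (aux t.+1)].
Qed.

Let mbelow t : measurable_fun setT (below t).
Proof.
case: t => [|t]; first exact: measurable_cst.
exact: (adaptedW (F_measurable (t := t))) (@below_adapted t).
Qed.

Let Sp_adapted t : measurable_fun setT (Sp t : G t -> R).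
Proof. by apply: measurable_maxr => //; exact: measurable_cst. Qed.

Let mSp t : measurable_fun setT (Sp t).
Proof. exact: (adaptedW (F_measurable (t := t))) (@Sp_adapted t). Qed.

Let Sp_le t x : Sp t x ^+ 2 <= S t x ^+ 2.
Proof.
rewrite /Sp; case: (lerP 0 (S t x)) => h//.
by rewrite expr0n sqr_ge0.
Qed.

Let below_norm t x : `|below t x| <= 1.
Proof. by case: (below01 t x) => ->; rewrite ?normr0 ?normr1. Qed.

Let V_int t : L1 (V t).
Proof.
apply: L1D.
  by apply: L1Z; apply: L1B; [exact: L1_cst|apply: (L1_le (Y := fun=> 1)) => //; exact: L1_cst].
apply: (L1_le (Y := fun x => b t * S t x ^+ 2)); last exact: L1Z.
  apply: measurable_funM => //; apply: measurable_funM => //.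
  exact: measurable_funX.
move=> x; rewrite normrM (ger0_norm (mulr_ge0 (b_ge0 t) (sqr_ge0 _))).
apply: le_trans (_ : 1 * (b t * Sp t x ^+ 2) <= _).
  by rewrite ler_wpM2r// mulr_ge0// sqr_ge0.
by rewrite mul1r ler_wpM2l.
Qed.

Let V_expect n : E (V n) <= \sum_(t < n) b t * E (fun x => M t x ^+ 2).
Proof.
elim: n => [|n IH].
  rewrite big_ord0 (_ : V 0%N = fun=> 0) ?E_cst//.
  by apply/funext => x; rewrite /V/= subrr mulr0 add0r mul1r /Sp /S big_ord0 maxxx expr0n mulr0.
rewrite big_ord_recr/=.
set xi := fun x => 2 * b n * below n.+1 x * Sp n x.
have axi : measurable_fun setT (xi : G n -> R).
  apply: measurable_funM => //; apply: measurable_funM; last exact: below_adapted.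
  exact: measurable_cst.
have xi0 x : 0 <= xi x.
  rewrite /xi; have Sp0 : 0 <= Sp n x by rewrite /Sp le_max lexx.
  have b0 := b_ge0 n; have B0 : 0 <= below n.+1 x by case: (below01 n.+1 x) => ->.
  exact: (mulr_ge0 (mulr_ge0 (mulr_ge0 (ler0n R 2) b0) B0) Sp0).
have ixi : L1 (fun x => xi x * M n x).
  apply: L1M => //; first exact: (adaptedW (F_measurable (t := n))).
  apply: (L1_le (Y := fun x => (2 * b n) ^+ 2 * S n x ^+ 2)); last exact: L1Z.
    by apply: measurable_funX; exact: (adaptedW (F_measurable (t := n))).
  move=> x; rewrite ger0_norm ?sqr_ge0// /xi -mulrA exprMn ler_wpM2l ?sqr_ge0//.
  apply: le_trans (Sp_le n x); rewrite exprMn ler_piMl ?sqr_ge0//.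
  by case: (below01 n.+1 x) => ->; rewrite ?expr0n ?expr1n.
have ib : L1 (fun x => b n * M n x ^+ 2) by exact: L1Z.
have iVx : L1 (fun x => V n x + xi x * M n x) by exact: L1D.
have : E (V n.+1) <= E (fun x => V n x + xi x * M n x + b n * M n x ^+ 2).
  by apply: E_le => //; exact: L1D.
have e1 := ED iVx ib; have e2 := ED (@V_int n) ixi; have e3 := EZ (b n) (@M_sqr n).
rewrite e1 e2 e3; have := M_drift axi xi0 ixi; lra.
Qed.

(** Markov's inequality: the potential equals [eps ^+ 2] once the barrier has been crossed, and the
    crossing events increase with [n]. *)
Lemma exceed_probability (r : R) :
  (forall n, \sum_(t < n) b t * E (fun x => M t x ^+ 2) <= r * eps ^+ 2) ->
  let A := \bigcup_n [set x | below n x <= 0] in measurable A /\ (P A <= r%:E)%E.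
Proof.
move=> Hr; pose A n := [set x | below n x <= 0].
have mA n : measurable (A n).
  rewrite -[X in measurable X]setTI.
  exact: (measurable_fun_le measurableT (@mbelow n) (measurable_cst _)).
have mUA : measurable (\bigcup_n A n) by exact: bigcupT_measurable.
have homoA : {homo A : n k / (n <= k)%N >-> (n <= k)%O}.
  apply/nondecreasing_seqP => n; apply/subsetPset => x; rewrite /A /=.
  by case: (below01 n x) => ->; rewrite ?ler10// mul0r.
have cv := @nondecreasing_cvg_mu _ _ _ P A mA mUA homoA.
split=> //; have <- := cvg_lim (@ereal_hausdorff R) cv.
apply: lime_le; first exact: cvgP cv.
apply: nearW => n /=; have [iA <-] := E_indic P (mA n).
rewrite lee_fin -(ler_pM2r (exprn_gt0 2 eps0)).
apply: le_trans (Hr n); apply: le_trans (V_expect n).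
rewrite mulrC -EZ//; apply: E_le => //; first exact: L1Z.
move=> x; have Sb : 0 <= b n * Sp n x ^+ 2 by rewrite mulr_ge0// sqr_ge0.
rewrite indicE /V; case: (below01 n x) => h; rewrite h.
  by rewrite mul0r subr0 addr0 mulr1 ler_piMr ?sqr_ge0//; case: (_ \in _).
rewrite memNset /= ?mulr0 ?subrr ?mulr0 ?add0r ?mul1r//.
by rewrite /A /= h ler10.
Qed.

Lemma below_zero n x : (m <= n)%N -> eps * n.+1%:R < S n x -> below n.+1 x = 0.
Proof. by move=> mn h /=; rewrite mn leNgt h/= mulr0. Qed.

End Hitting.

(** Outside the crossing event [A m] the barrier bound holds for all [t >= m]. The delayed weights
    make these events arbitrarily improbable, so their intersection over [m] is negligible. *)
Lemma supermartingale_strong_law :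
  {ae P, forall x, forall r, 0 < r -> exists N, forall t, (N <= t)%N ->
    \sum_(s < t) M s x <= r * t.+1%:R}.
Proof.
suff H k : {ae P, forall x, exists N, forall t, (N <= t)%N ->
    S t x <= k.+1%:R^-1 * t.+1%:R}.
  move/ae_foralln : H; apply: filterS => x H r r0.
  have [N HN] := H (Num.bound r^-1); exists N => t Nt.
  apply: le_trans (HN t Nt) _; rewrite ler_wpM2r//.
  rewrite -[leRHS]invrK lef_pV2 ?posrE ?invr_gt0//.
  apply: le_trans (ltW (archi_boundP _)) _; first by rewrite invr_ge0 ltW.
  by rewrite ler_nat.
set eps := _^-1; have eps0 : 0 < eps by rewrite invr_gt0 ltr0n.
pose A m := \bigcup_n [set x | below eps m n x <= 0].
have small (r : R) : 0 < r -> exists m, measurable (A m) /\ (P (A m) <= r%:E)%E.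
  move=> r0.
  pose e t := (t.+1%:R ^+ 2)^-1 * E (fun x => M t x ^+ 2).
  have e0 t : 0 <= e t.
    by rewrite mulr_ge0 ?invr_ge0 ?exprn_ge0//; apply: E_ge0 => x; exact: sqr_ge0.
  have [m Hm] := delayed_weight_series e0 M_sum (mulr_gt0 r0 (exprn_gt0 2 eps0)).
  exists m; apply: exceed_probability => // n; apply: le_trans (Hm n).
  rewrite le_eqVlt; apply/orP; left; apply/eqP/eq_bigr => t _.
  by rewrite /e (mulrA (_ ^+ 2)) divff ?mul1r// expf_neq0// pnatr_eq0.
have neg : P.-negligible (\bigcap_(m in [set m | measurable (A m)]) A m).
  have [f Hf] : exists f : nat -> nat, forall k,
      measurable (A (f k)) /\ (P (A (f k)) <= (k.+1%:R^-1 : R)%:E)%E.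
    have [j|f Hf] := @choice nat nat
        (fun k m => d.-measurable (A m) /\ (P (A m) <= (k.+1%:R^-1 : R)%:E)%E).
      by apply: small; rewrite invr_gt0 ltr0n.
    by exists f.
  apply: (@negligibleS _ _ _ _ (\bigcap_k A (f k))).
    by move=> x Hx j _; apply: Hx; exact: (Hf j).1.
  have mI : measurable (\bigcap_k A (f k)) by apply: bigcapT_measurable => j; exact: (Hf j).1.
  apply/negligibleP => //; apply/eqP; rewrite -measure_le0.
  apply/lee_addgt0Pr => r r0; rewrite add0e.
  apply: le_trans (_ : P (A (f (Num.bound r^-1))) <= _)%E.
    by apply: le_measure; rewrite ?inE//; [exact: (Hf _).1|move=> x; exact].
  apply: le_trans (Hf _).2 _; rewrite lee_fin.
  rewrite -[leRHS]invrK lef_pV2 ?posrE ?invr_gt0//.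
  apply: le_trans (ltW (archi_boundP _)) _; first by rewrite invr_ge0 ltW.
  by rewrite ler_nat.
apply: negligibleS neg => x /= Hx m _.
apply: contrapT => nA; apply: Hx; exists m => t mt.
rewrite leNgt; apply/negP => h; apply: nA; exists t.+1 => //=.
by have := below_zero mt h => /= ->.
Qed.

End StrongLaw.

(** * Pointwise inequalities and the weight sequence *)

Section Scalar.
Context {R : realType}.
Implicit Types (u v e nu : R).

(** From [2 a^3 <= a^2 + a^4]: third powers of increments are traded for [nu^2], whose expectation
    is bounded. *)
Lemma abs_cube_le e nu : e ^+ 2 <= nu -> `|e| ^+ 3 <= 1 + nu ^+ 2.
Proof.
move=> h; have e4 : e ^+ 2 * e ^+ 2 <= nu * nu by rewrite ler_pM ?sqr_ge0.
have a2 : `|e| ^+ 2 = e ^+ 2 by rewrite real_normK// num_real.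
have := mulr_ge0 (sqr_ge0 `|e|) (sqr_ge0 (1 - `|e|)).
by have := sqr_ge0 (nu - 1); rewrite -a2 in e4 h *; nra.
Qed.

(** With [e = v - u], the increment of the cube is exactly [3 u] times that of half the square, plus
    [e^2 (3 u / 2 + e)]. *)
Lemma cubic_increment u v nu : 1 <= u -> 0 <= v -> (v - u) ^+ 2 <= nu ->
  v ^+ 3 - u ^+ 3 <= 3 * (u * ((v ^+ 2 - u ^+ 2) / 2)) + 3 / 2 * (u * nu) + 1 + nu ^+ 2.
Proof.
move=> u1 v0 h; set e := v - u in h.
have nu0 : 0 <= nu by apply: le_trans h; exact: sqr_ge0.
have id : v ^+ 3 - u ^+ 3 = 3 * (u * ((v ^+ 2 - u ^+ 2) / 2)) + e ^+ 2 * (3 / 2 * u + e).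
  by rewrite /e; field.
have h1 : e ^+ 2 * u <= nu * u by rewrite ler_wpM2r//; lra.
have h2 : e ^+ 2 * e <= 1 + nu ^+ 2.
  apply: le_trans (abs_cube_le h); rewrite (exprSr `|e|) real_normK ?num_real//.
  by rewrite ler_wpM2l ?sqr_ge0 ?ler_norm.
rewrite id; nra.
Qed.

(** Carries integrability of the cube from one time to the next, by [(u + a)^3 <= 4 u^3 + 4 a^3]. *)
Lemma cube_growth u v nu : 1 <= u -> 0 <= v -> (v - u) ^+ 2 <= nu ->
  v ^+ 3 <= 4 * u ^+ 3 + 4 * (1 + nu ^+ 2).
Proof.
move=> u1 v0 h; set e := v - u in h.
have e4 : e ^+ 2 * e ^+ 2 <= nu * nu by rewrite ler_pM ?sqr_ge0.
have nu0 : 0 <= nu by apply: le_trans h; exact: sqr_ge0.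
have a0 := normr_ge0 e; have ea : e <= `|e| := ler_norm e.
have a2 : `|e| ^+ 2 = e ^+ 2 by rewrite real_normK// num_real.
have va : v <= u + `|e| by move: ea; rewrite /e; lra.
have v3 : v ^+ 3 <= (u + `|e|) ^+ 3 by rewrite ler_pXn2r// nnegrE; lra.
have a3 := abs_cube_le h.
have m : (u + `|e|) ^+ 3 <= 4 * u ^+ 3 + 4 * `|e| ^+ 3.
  have -> : 4 * u ^+ 3 + 4 * `|e| ^+ 3 = (u + `|e|) ^+ 3 + 3 * (u + `|e|) * (u - `|e|) ^+ 2.
    by ring.
  by rewrite lerDl mulr_ge0 ?sqr_ge0//; lra.
lra.
Qed.

(** The first bound makes [u] times the drift integrable; the second controls its second moment,
    leaving the mixed term [u ^+ 2 * nu]. *)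
Lemma energy_increment u v nu : 1 <= u -> 0 <= v -> (v - u) ^+ 2 <= nu ->
  u * `|(v ^+ 2 - u ^+ 2) / 2| <= 4 * (u ^+ 3 + 1 + nu ^+ 2) /\
  ((v ^+ 2 - u ^+ 2) / 2) ^+ 2 <= 2 * (u ^+ 2 * nu) + nu ^+ 2.
Proof.
move=> u1 v0 h; set e := v - u in h.
have e4 : e ^+ 2 * e ^+ 2 <= nu * nu by rewrite ler_pM ?sqr_ge0.
have nu0 : 0 <= nu by apply: le_trans h; exact: sqr_ge0.
have id : (v ^+ 2 - u ^+ 2) / 2 = e * (u + e / 2) by rewrite /e; field.
have a0 := normr_ge0 e; have ea : e <= `|e| := ler_norm e.
have a2 : `|e| ^+ 2 = e ^+ 2 by rewrite real_normK// num_real.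
have a3 := abs_cube_le h.
rewrite id; split.
  have h1 : `|e * (u + e / 2)| <= `|e| * (u + `|e|).
    rewrite normrM ler_wpM2l//; apply: le_trans (ler_normD _ _) _.
    by rewrite normrM (ger0_norm (_ : 0 <= u)) ?(ger0_norm (_ : 0 <= 2^-1)); lra.
  apply: le_trans (_ : u * (`|e| * (u + `|e|)) <= _).
    by rewrite ler_wpM2l//; lra.
  have h2 : u * (`|e| * (u + `|e|)) <= 2 * (u ^+ 3 + `|e| ^+ 3).
    have ua : 0 <= u + `|e| by lra.
    by have := mulr_ge0 ua (sqr_ge0 (u - `|e|)); nra.
  nra.
rewrite exprMn.
have h3 : (u + e / 2) ^+ 2 <= 2 * u ^+ 2 + e ^+ 2.
  by have := sqr_ge0 (u - e / 2); nra.
apply: le_trans (_ : e ^+ 2 * (2 * u ^+ 2 + e ^+ 2) <= _).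
  by rewrite ler_wpM2l ?sqr_ge0.
have : e ^+ 2 * u ^+ 2 <= nu * u ^+ 2 by rewrite ler_wpM2r ?sqr_ge0.
nra.
Qed.

(** The term [- 3 eta u^2] splits in three: two parts complete the squares against [3 u (C + eta)]
    and [3 / 2 u nu], and one survives. *)
Lemma drift_completion u nu N C eta : 1 <= u -> 0 < eta -> eta * (u - 1) <= N ->
  3 * (u * (C - N)) + 3 / 2 * (u * nu) + 1 + nu ^+ 2 <=
  - eta * u ^+ 2 + (9 / 4 * (C + eta) ^+ 2 / eta + 1) + (9 / 16 / eta + 1) * nu ^+ 2.
Proof.
move=> u1 eta0 h1.
have h2 : u * (C - N) <= u * (C - eta * (u - 1)).
  by rewrite ler_wpM2l//; lra.
have h3 : 3 * (u * (C + eta)) <= eta * u ^+ 2 + 9 / 4 * (C + eta) ^+ 2 / eta.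
  rewrite -subr_ge0 (_ : _ - _ = (2 * eta * u - 3 * (C + eta)) ^+ 2 / (4 * eta)).
    by rewrite divr_ge0 ?sqr_ge0//; lra.
  by field; rewrite gt_eqF.
have h4 : 3 / 2 * (u * nu) <= eta * u ^+ 2 + 9 / 16 / eta * nu ^+ 2.
  rewrite -subr_ge0 (_ : _ - _ = (4 * eta * u - 3 * nu) ^+ 2 / (16 * eta)).
    by rewrite divr_ge0 ?sqr_ge0//; lra.
  by field; rewrite gt_eqF.
have h5 : 3 * (u * (C - N)) <= 3 * (u * (C + eta)) - 3 * (eta * u ^+ 2).
  lra.
lra.
Qed.

(* [alpha_t = (t+1)^(-4/3)]. *)
Lemma four_thirds_weight : exists alpha : nat -> R,
  [/\ forall t, 0 < alpha t, forall t, alpha t.+1 <= alpha t,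
      forall t, (t.+1%:R ^+ 2)^-1 <= alpha t,
      forall n, \sum_(t < n) alpha t <= 4 &
      forall t, ((t.+1%:R ^+ 2)^-1) ^+ 2 <= alpha t ^+ 3].
Proof.
(* The cube root turns all fractional powers into integer powers of [r]. *)
pose r (t : nat) : R := t.+1%:R `^ (3%:R^-1).
have r3 t : r t ^+ 3 = t.+1%:R.
  rewrite /r -powR_mulrn ?powR_ge0// -powRrM mulVf ?pnatr_eq0//.
by rewrite powRr1.
have r0 t : 0 < r t by rewrite powR_gt0.
have rS t : r t <= r t.+1 by rewrite /r ge0_ler_powR ?nnegrE ?invr_ge0// ler_nat.
have r1 t : 1 <= r t.
  by rewrite -(@ler_pXn2r _ 3) ?nnegrE ?(ltW (r0 t))// expr1n r3 ler1n.
exists (fun t => (r t ^+ 4)^-1); split.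
- by move=> t; rewrite invr_gt0 exprn_gt0.
- by move=> t; rewrite lef_pV2 ?posrE ?exprn_gt0// ler_pXn2r ?nnegrE ?(ltW (r0 _)).
- move=> t; rewrite lef_pV2 ?posrE ?exprn_gt0// -r3 -exprM.
  by rewrite ler_weXn2l.
(* Telescoping comparison with [- 3 x^(-1/3)]: the relation [b ^+ 3 - a ^+ 3 = 1] gives
   [3 b^2 (b - a) >= 1]. The initial term 1 and the telescoped 3 make the bound 4. *)
- have step t : (r t.+1 ^+ 4)^-1 <= 3 * ((r t)^-1 - (r t.+1)^-1).
    have e : r t.+1 ^+ 3 - r t ^+ 3 = 1 by rewrite !r3 -natr1 addrAC subrr add0r.
    move: (r0 t) (r0 t.+1) (rS t) e; move: (r t) (r t.+1) => a b a0 b0 ab e.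
    have -> : 3 * (a^-1 - b^-1) = 3 * ((b - a) / (a * b)).
      by field; rewrite !gt_eqF.
    have ba : 0 <= b - a by lra.
    rewrite mulrA ler_pdivlMr ?mulr_gt0// mulrC ler_pdivrMr ?exprn_gt0//.
    have f : 1 <= 3 * b ^+ 2 * (b - a).
      rewrite -e (_ : b ^+ 3 - a ^+ 3 = (b ^+ 2 + a * b + a ^+ 2) * (b - a)); last by ring.
      rewrite ler_wpM2r//; nra.
    have g : a * b <= b ^+ 2 by rewrite expr2 ler_wpM2r// ltW.
    apply: le_trans g _; rewrite -[leLHS]mulr1.
    rewrite (_ : 3 * (b - a) * b ^+ 4 = b ^+ 2 * (3 * b ^+ 2 * (b - a))); last by ring.
    by rewrite ler_wpM2l ?sqr_ge0.
  suff H n : \sum_(t < n.+1) (r t ^+ 4)^-1 <= 1 + 3 * (1 - (r n)^-1).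
    case=> [|n]; first by rewrite big_ord0.
    apply: le_trans (H n) _; have : 0 <= (r n)^-1 by rewrite invr_ge0 ltW.
    lra.
  elim: n => [|n IH].
    have -> : r 0%N = 1 by rewrite /r powR1.
    by rewrite big_ord_recr big_ord0/= /r powR1 expr1n invr1; lra.
  by rewrite big_ord_recr/=; have := step n; lra.
- move=> t; rewrite -r3 -!exprVn -!exprM; exact: lexx.
Qed.

Lemma limn_esup_le (f : nat -> R) (c : R) :
  (forall r, 0 < r -> exists N, forall t, (N <= t)%N -> f t <= c + r) ->
  (limn_esup (fun t => (f t)%:E) <= c%:E)%E.
Proof.
move=> H; apply/lee_addgt0Pr => r r0; have [N HN] := H r r0.
apply: (@le_trans _ _ (ereal_sup [set (f t)%:E | t in [set t | (N <= t)%N]])).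
  by apply: ereal_inf_lbound; exists [set t | (N <= t)%N] => //; exists N.
by apply: ub_ereal_sup => _ [t Nt <-]; rewrite -EFinD lee_fin HN.
Qed.

Lemma sqr_sum_le (I : Type) (s : seq I) (a : I -> R) :
  (\sum_(i <- s) a i) ^+ 2 <= (size s)%:R * \sum_(i <- s) a i ^+ 2.
Proof.
elim: s => [|i s IH]; first by rewrite !big_nil expr0n mul0r.
rewrite !big_cons/=.
have h : 2 * (a i * \sum_(j <- s) a j) <= (size s)%:R * a i ^+ 2 + \sum_(j <- s) a j ^+ 2.
  elim: s {IH} => [|j s IH]; first by rewrite !big_nil mulr0 mul0r addr0 mulr0.
  by rewrite !big_cons/= -natr1; have := sqr_ge0 (a i - a j); nra.
rewrite -natr1; nra.
Qed.

Lemma sum_sqr_le_sqr_sum (I : Type) (s : seq I) (a : I -> R) : (forall i, 0 <= a i) ->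
  \sum_(i <- s) a i ^+ 2 <= (\sum_(i <- s) a i) ^+ 2.
Proof.
move=> a0; elim: s => [|i s IH]; first by rewrite !big_nil expr0n.
rewrite !big_cons sqrrD -addrA lerD2l (le_trans IH)// lerDr mulrn_wge0// mulr_ge0//.
by rewrite sumr_ge0.
Qed.

End Scalar.

(** * Moment bounds for an abstract Lyapunov process *)

Section LyapunovCore.
Context {d : measure_display} {T : measurableType d} {R : realType}.
Variable P : probability T R.
Local Notation L1 X := (P.-integrable setT (EFin \o X)).
Local Notation E X := (Rintegral P setT X).
Variable F : nat -> set (set T).
Hypothesis F_measurable : forall t, <<s F t >> `<=` measurable.
Hypothesis F_mono : forall t, <<s F t >> `<=` <<s F t.+1 >>.
Local Notation G t := (g_sigma_algebraType (F t)).
(** [U] abstracts the shifted norm of the queues, [N] the sum of the [|Q_k|], and [nu] the weighted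
    sum of squared increments. *)
Variables (U N nu p : nat -> T -> R) (eps eta Lam C D cp : R).
Hypothesis U_adapted : forall t, measurable_fun setT (U t : G t -> R).
Hypothesis N_adapted : forall t, measurable_fun setT (N t : G t -> R).
Hypothesis p_adapted : forall t, measurable_fun setT (p t : G t.+1 -> R).
Hypothesis U_ge1 : forall t x, 1 <= U t x.
Hypothesis N_ge0 : forall t x, 0 <= N t x.
Hypothesis eps0 : 0 < eps.
Hypothesis eta0 : 0 < eta.
Hypothesis U_le : forall t x, eta * (U t x - 1) <= eps * N t x.
Hypothesis N_le : forall t x, N t x <= Lam * U t x.
Hypothesis U_inc : forall t x, (U t.+1 x - U t x) ^+ 2 <= nu t x.
Hypothesis nu_sqr : forall t, L1 (fun x => nu t x ^+ 2).
Hypothesis nu_bound : forall t, E (fun x => nu t x ^+ 2) <= D.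
Hypothesis p_sqr : forall t, L1 (fun x => p t x ^+ 2).
Hypothesis p_sum : forall n,
  \sum_(t < n) (t.+1%:R ^+ 2)^-1 * E (fun x => p t x ^+ 2) <= cp.

Let dL t x := (U t.+1 x ^+ 2 - U t x ^+ 2) / 2.

Hypothesis drift : forall t, cond_nonpos P (F t) (fun x => dL t x + eps * N t x - C).

Variable m : nat.

(* Indicator of an event of [F 0] on which [U 0] is bounded; it makes all moments finite. *)
Let g x : R := (U 0%N x <= m%:R)%R%:R.

Let g01 x : g x = 0 \/ g x = 1.
Proof. by rewrite /g; case: (_ <= _); [right|left]. Qed.

Let g_adapted t : measurable_fun setT (g : G t -> R).
Proof. by elim: t => [|t IH]; [exact: adapted_ler|exact: adaptedS]. Qed.

Let mT t (X : T -> R) : measurable_fun setT (X : G t -> R) -> measurable_fun setT X.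
Proof. exact: (adaptedW (@F_measurable t)). Qed.

Let mU t : measurable_fun setT (U t). Proof. exact: (mT (@U_adapted t)). Qed.
Let mN t : measurable_fun setT (N t). Proof. exact: (mT (@N_adapted t)). Qed.
Let mp t : measurable_fun setT (p t). Proof. exact: (mT (@p_adapted t)). Qed.
Let mg : measurable_fun setT g. Proof. exact: (mT (@g_adapted 0%N)). Qed.
Let mdL t : measurable_fun setT (dL t).
Proof.
apply: measurable_funM; last exact: measurable_cst.
by apply: measurable_funB; apply: measurable_funX.
Qed.

Let U_ge0 t x : 0 <= U t x. Proof. by apply: le_trans (U_ge1 t x). Qed.

Let D0 : 0 <= D.
Proof. by apply: le_trans (nu_bound 0); apply: E_ge0 => x; exact: sqr_ge0. Qed.

Let cube_int t : L1 (fun x => g x * U t x ^+ 3).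
Proof.
elim: t => [|t IH].
  apply: (L1_le (Y := fun=> m%:R ^+ 3)); last exact: L1_cst.
    by apply: measurable_funM => //; exact: measurable_funX.
  move=> x; rewrite /g; case: (lerP (U 0%N x) m%:R) => h; last by rewrite mul0r normr0 exprn_ge0.
  by rewrite mul1r ger0_norm ?exprn_ge0// ler_pXn2r// nnegrE.
apply: (L1_le (Y := fun x => 4 * (g x * U t x ^+ 3) + 4 * (1 + nu t x ^+ 2))).
- by apply: measurable_funM => //; exact: measurable_funX.
- move=> x; have h := cube_growth (U_ge1 t x) (U_ge0 t.+1 x) (U_inc t x).
  have := sqr_ge0 (nu t x); case: (g01 x) => ->.
    by rewrite !mul0r mulr0 normr0; lra.
  by move=> _; rewrite !mul1r ger0_norm ?exprn_ge0.
- apply: L1D; first exact: L1Z.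
  by apply: L1Z; apply: L1D => //; exact: L1_cst.
Qed.

Let sqr_le_cube t x : U t x ^+ 2 <= U t x ^+ 3 /\ U t x <= U t x ^+ 3.
Proof.
have u1 := U_ge1 t x; split; rewrite exprS; first by rewrite ler_peMl ?sqr_ge0.
by rewrite ler_peMr// exprn_ege1.
Qed.

Let sqr_int t : L1 (fun x => g x * U t x ^+ 2).
Proof.
apply: (L1_le (Y := fun x => g x * U t x ^+ 3)) => //.
  by apply: measurable_funM => //; exact: measurable_funX.
move=> x; have [h _] := sqr_le_cube t x.
by case: (g01 x) => ->; rewrite ?mul0r ?normr0// !mul1r ger0_norm ?sqr_ge0.
Qed.

Let drift_int t : L1 (fun x => (g x * U t x) * (dL t x + eps * N t x - C)).
Proof.
apply: (L1_le (Y := fun x => (4 + eps * Lam + `|C|) * (g x * U t x ^+ 3)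
   + 4 * (1 + nu t x ^+ 2))).
- apply: measurable_funM; first exact: measurable_funM.
  apply: measurable_funB => //; apply: measurable_funD => //.
  exact: measurable_funM.
- move=> x; have [h _] := energy_increment (U_ge1 t x) (U_ge0 t.+1 x) (U_inc t x).
  have := sqr_ge0 (nu t x); case: (g01 x) => ->.
    by rewrite !mul0r mulr0 normr0; lra.
  move=> nu2; rewrite !mul1r normrM ger0_norm//.
  have [h2 h1] := sqr_le_cube t x.
  have hN : U t x * (eps * N t x) <= eps * Lam * U t x ^+ 3.
    have Lam0 : 0 <= Lam.
      have := le_trans (N_ge0 t x) (N_le t x); rewrite pmulr_lge0//.
      exact: lt_le_trans (U_ge1 t x).
    apply: le_trans (_ : U t x * (eps * (Lam * U t x)) <= _).
      by rewrite ler_wpM2l// ler_wpM2l// ltW.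
    rewrite (_ : U t x * (eps * (Lam * U t x)) = eps * Lam * U t x ^+ 2); last by ring.
    by rewrite ler_wpM2l// mulr_ge0// ltW.
  have hC : U t x * `|C| <= `|C| * U t x ^+ 3 by rewrite mulrC ler_wpM2l.
  have : `|dL t x + eps * N t x - C| <= `|dL t x| + eps * N t x + `|C|.
    apply: le_trans (ler_normB _ _) _; rewrite lerD2r.
    apply: le_trans (ler_normD _ _) _; rewrite lerD2l ger0_norm// mulr_ge0//.
    exact: ltW.
  move=> /(ler_wpM2l (U_ge0 t x)) /le_trans; apply.
  by rewrite !mulrDr; rewrite /dL; lra.
- apply: L1D; first exact: L1Z.
  by apply: L1Z; apply: L1D => //; exact: L1_cst.
Qed.

Let c1 := 9 / 4 * (C + eta) ^+ 2 / eta + 1.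
Let c2 := 9 / 16 / eta + 1.

Let c1_ge0 : 0 <= c1.
Proof.
have h : 0 <= 9 / 4 * (C + eta) ^+ 2 by have := sqr_ge0 (C + eta); lra.
exact: addr_ge0 (divr_ge0 h (ltW eta0)) ler01.
Qed.

Let c2_ge0 : 0 <= c2.
Proof.
have h : 0 <= 9 / 16 :> R by lra.
exact: addr_ge0 (divr_ge0 h (ltW eta0)) ler01.
Qed.

(** The weight [g * U t] is nonnegative and known at time [t], so the weighted drift has nonpositive
    expectation. In the remainder [g <= 1] leaves [nu t ^+ 2] unweighted, within reach of the bound
    [D]. *)
Let cube_step t : E (fun x => g x * U t.+1 x ^+ 3) <=
  E (fun x => g x * U t x ^+ 3) - eta * E (fun x => g x * U t x ^+ 2) + (c1 + c2 * D).
Proof.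
set Z := fun x => (g x * U t x) * (dL t x + eps * N t x - C).
have iZ : L1 Z by exact: drift_int.
have agU : measurable_fun setT ((fun x => g x * U t x) : G t -> R).
  exact: measurable_funM.
have gU0 x : 0 <= g x * U t x by rewrite mulr_ge0//; case: (g01 x) => ->.
have EZ0 : E Z <= 0 := cond_nonpos_mul (@F_measurable t) (@drift t) agU gU0 iZ.
have ia : L1 (fun x => g x * U t x ^+ 3 + 3 * Z x) by apply: L1D => //; exact: L1Z.
have ib : L1 (fun x => - eta * (g x * U t x ^+ 2)) by exact: L1Z.
have ic : L1 (fun x => c1 + c2 * nu t x ^+ 2) by apply: L1D; [exact: L1_cst|exact: L1Z].
have iab := L1D ia ib; have iabc := L1D iab ic.
have le1 : E (fun x => g x * U t.+1 x ^+ 3) <=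
    E (fun x => g x * U t x ^+ 3 + 3 * Z x + - eta * (g x * U t x ^+ 2)
                + (c1 + c2 * nu t x ^+ 2)).
  apply: E_le => // x; rewrite /Z; case: (g01 x) => ->.
    by rewrite !mul0r !mulr0 !add0r addr_ge0// mulr_ge0// sqr_ge0.
  have := cubic_increment (U_ge1 t x) (U_ge0 t.+1 x) (U_inc t x).
  have := drift_completion (nu t x) C (U_ge1 t x) eta0 (U_le t x).
  rewrite -/c1 -/c2 -/(dL t x) !mul1r; lra.
have e1 := ED iab ic; have e2 := ED ia ib; have e3 := ED (@cube_int t) (L1Z 3 iZ).
have e4 := EZ 3 iZ; have e5 := EZ (- eta) (@sqr_int t).
have e6 := ED (L1_cst P c1) (L1Z c2 (@nu_sqr t)); have e7 := EZ c2 (@nu_sqr t).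
have e8 := E_cst P c1.
move: le1; rewrite e1 e2 e3 e4 e5 e6 e7 e8.
have := ler_wpM2l c2_ge0 (nu_bound t); lra.
Qed.

Variable alpha : nat -> R.
Hypothesis alpha_gt0 : forall t, 0 < alpha t.
Hypothesis alpha_decr : forall t, alpha t.+1 <= alpha t.
Hypothesis alpha_sum : forall n, \sum_(t < n) alpha t <= 4.
Hypothesis alpha_cube : forall t, ((t.+1%:R ^+ 2)^-1) ^+ 2 <= alpha t ^+ 3.
Hypothesis alpha_ge : forall t, (t.+1%:R ^+ 2)^-1 <= alpha t.

Let cw := (4 * (c1 + c2 * D) + alpha 0 * E (fun x => g x * U 0 x ^+ 3)) / eta.

(** Summation by parts: as the weights decrease, [alpha n * y n.+1] covers [alpha n.+1 * y n.+1], so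
    the third moments telescope. The 4 in [cw] bounds the sum of the weights. *)
Let weighted_sqr_sum n : \sum_(t < n) alpha t * E (fun x => g x * U t x ^+ 2) <= cw.
Proof.
pose y t := E (fun x => g x * U t x ^+ 3).
have y0 t : 0 <= y t.
  by apply: E_ge0 => x; rewrite mulr_ge0 ?exprn_ge0//; case: (g01 x) => ->.
have H : eta * (\sum_(t < n) alpha t * E (fun x => g x * U t x ^+ 2)) <=
    (\sum_(t < n) alpha t) * (c1 + c2 * D) + alpha 0 * y 0%N - alpha n * y n.
  elim: n => [|n IH]; first by rewrite !big_ord0; lra.
  rewrite !big_ord_recr/=.
  have h1 := ler_wpM2l (ltW (alpha_gt0 n)) (cube_step n); rewrite -/(y n) -/(y n.+1) in h1.
  have h2 := ler_wpM2r (y0 n.+1) (alpha_decr n).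
  rewrite mulrDr mulrDl; lra.
rewrite /cw ler_pdivlMr// mulrC.
apply: le_trans H _.
have c0 : 0 <= c1 + c2 * D by rewrite addr_ge0// mulr_ge0.
have h1 := ler_wpM2r c0 (alpha_sum n).
have h2 := mulr_ge0 (ltW (alpha_gt0 n)) (y0 n).
by rewrite -/(y 0%N); lra.
Qed.

Lemma weighted_energy_vanishes : {ae P, forall x, U 0%N x <= m%:R ->
  forall r, 0 < r -> exists n0, forall t, (n0 <= t)%N -> alpha t * U t x ^+ 2 <= r}.
Proof.
pose X t x := alpha t * (g x * U t x ^+ 2).
have X0 t x : 0 <= X t x.
  have g0 : 0 <= g x by case: (g01 x) => ->.
  exact: mulr_ge0 (ltW (alpha_gt0 t)) (mulr_ge0 g0 (sqr_ge0 _)).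
have iX t : L1 (X t) by exact: L1Z.
have sX n : \sum_(t < n) E (X t) <= cw.
  apply: le_trans (weighted_sqr_sum n); rewrite le_eqVlt; apply/orP; left; apply/eqP.
  by apply: eq_bigr => t _; rewrite EZ.
have := ae_series_eventually_le X0 iX sX; apply: filterS => x Hx xm r r0.
have [n0 h] := Hx r r0; exists n0 => t /h.
by rewrite /X /g xm mul1r.
Qed.

(** * Strong law for the truncated drift *)

Section DriftLaw.
(** Two instances are used: [theta = V] for the average of [p], and [theta = 0], with [p] bounded
    below by [pmin], for that of the queues. *)
Variables (theta b : R).
Hypothesis theta_drift : forall t,
  cond_nonpos P (F t) (fun x => dL t x + theta * p t x + eps * N t x - b).

Let Z t x := dL t x + theta * p t x + eps * N t x - b.

Let J t x : R := g x * (alpha t * U t x ^+ 2 <= 1)%R%:R.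

Let J_adapted t : measurable_fun setT (J t : G t -> R).
Proof.
apply: measurable_funM => //; apply: adapted_ler.
by apply: measurable_funM; [exact: measurable_cst|exact: measurable_funX].
Qed.

Let J01 t x : J t x = 0 \/ [/\ J t x = 1, g x = 1 & alpha t * U t x ^+ 2 <= 1].
Proof.
rewrite /J; case: (g01 x) => ->; first by left; rewrite mul0r.
by case: (lerP (alpha t * U t x ^+ 2) 1) => h; [right; rewrite mul1r|left; rewrite mulr0].
Qed.

Let tau t : R := (t.+1%:R ^+ 2)^-1.

Let tau_gt0 t : 0 < tau t. Proof. by rewrite invr_gt0 exprn_gt0. Qed.

Let tau_le t : tau t <= alpha t. Proof. exact: alpha_ge. Qed.

(** Each summand has summable expectations. The factor 4 comes from squaring a sum of four terms;
    the coefficient 1 and one of the two copies of [alpha t * nu t x ^+ 2] come from the mixed term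
    [U^2 nu]. *)
Let bound t x := 4 * ((1 + (eps * Lam) ^+ 2) * (alpha t * (g x * U t x ^+ 2))
    + 2 * (alpha t * nu t x ^+ 2) + theta ^+ 2 * (tau t * p t x ^+ 2) + b ^+ 2 * alpha t).

Let M_le t x : tau t * (J t x * Z t x) ^+ 2 <= bound t x.
Proof.
have a0 := alpha_gt0 t; have t0 := tau_gt0 t; have ta := tau_le t.
have p1 : 0 <= theta ^+ 2 * (tau t * p t x ^+ 2).
  by rewrite mulr_ge0 ?sqr_ge0// mulr_ge0 ?sqr_ge0 ?ltW.
have p2 : 0 <= alpha t * nu t x ^+ 2 by rewrite mulr_ge0 ?sqr_ge0 ?ltW.
have p3 : 0 <= b ^+ 2 * alpha t by rewrite mulr_ge0 ?sqr_ge0 ?ltW.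
have p0 : 0 <= (1 + (eps * Lam) ^+ 2) * (alpha t * (g x * U t x ^+ 2)).
  have g0 : 0 <= g x by case: (g01 x) => ->.
  apply: mulr_ge0; first by rewrite addr_ge0 ?sqr_ge0.
  exact: mulr_ge0 (ltW a0) (mulr_ge0 g0 (sqr_ge0 _)).
rewrite /bound; case: (J01 t x) => [->|[-> -> aU]].
  by rewrite mul0r expr0n mulr0; lra.
rewrite !mul1r.
have [_ h] := energy_increment (U_ge1 t x) (U_ge0 t.+1 x) (U_inc t x).
rewrite -/(dL t x) in h.
have q : Z t x ^+ 2 <= 4 * (dL t x ^+ 2 + theta ^+ 2 * p t x ^+ 2
    + (eps * N t x) ^+ 2 + b ^+ 2).
  rewrite -exprMn /Z; move: (dL t x) (theta * _) (eps * _) => x1 x2 x3.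
  have := sqr_ge0 (x1 - x2); have := sqr_ge0 (x1 - x3); have := sqr_ge0 (x1 + b).
  have := sqr_ge0 (x2 - x3); have := sqr_ge0 (x2 + b); have := sqr_ge0 (x3 + b).
  nra.
have qN : tau t * (eps * N t x) ^+ 2 <= (eps * Lam) ^+ 2 * (alpha t * U t x ^+ 2).
  have -> : (eps * Lam) ^+ 2 * (alpha t * U t x ^+ 2) =
      alpha t * (eps * (Lam * U t x)) ^+ 2 by ring.
  have e0 := ltW eps0; have n0 := N_ge0 t x; have nl := N_le t x.
  have k1 := ler_wpM2l e0 nl; have k0 := mulr_ge0 e0 n0; have k2 := le_trans k0 k1.
  by apply: ler_pM; rewrite ?sqr_ge0 ?(ltW t0)// ler_pXn2r.
(* Here the truncation acts: [alpha U^2 <= 1] and [tau^2 <= alpha^3] give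
   [tau^2 U^4 <= alpha^2 U^2], and [(tau U^2 - alpha nu)^2 >= 0] separates [U] from [nu]. *)
have qU : 2 * (tau t * (U t x ^+ 2 * nu t x)) <= alpha t * (U t x ^+ 2 + nu t x ^+ 2).
  have k1 : tau t ^+ 2 * U t x ^+ 4 <= alpha t ^+ 2 * U t x ^+ 2.
    apply: le_trans (_ : alpha t ^+ 3 * U t x ^+ 4 <= _).
      exact: ler_wpM2r (exprn_ge0 4 (U_ge0 t x)) _ _ (alpha_cube t).
    have -> : alpha t ^+ 3 * U t x ^+ 4 = (alpha t * U t x ^+ 2) * (alpha t ^+ 2 * U t x ^+ 2).
      by ring.
    by rewrite ler_piMl// mulr_ge0 ?sqr_ge0.
  rewrite -(ler_pM2l a0).
  have k2 := sqr_ge0 (tau t * U t x ^+ 2 - alpha t * nu t x).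
  apply: le_trans (_ : tau t ^+ 2 * U t x ^+ 4 + alpha t ^+ 2 * nu t x ^+ 2 <= _).
    rewrite -subr_ge0 (_ : _ - _ = (tau t * U t x ^+ 2 - alpha t * nu t x) ^+ 2)//.
    by ring.
  have -> : alpha t * (alpha t * (U t x ^+ 2 + nu t x ^+ 2)) =
     alpha t ^+ 2 * U t x ^+ 2 + alpha t ^+ 2 * nu t x ^+ 2 by ring.
  by rewrite lerD2r.
have q1 := ler_wpM2l (ltW t0) q.
have q2 := ler_wpM2l (ltW t0) h.
have q3 := ler_wpM2r (sqr_ge0 (nu t x)) ta.
have q4 := ler_wpM2r (sqr_ge0 b) ta.
apply: le_trans q1 _; rewrite !mulrDr in q2 qU *.
rewrite !mulrDl; lra.
Qed.

Let bound_int t : L1 (bound t).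
Proof.
apply: L1Z; apply: L1D; last exact: L1_cst.
apply: L1D; last by apply: L1Z; apply: L1Z.
by apply: L1D; do 2 apply: L1Z.
Qed.

Let bound_expect t : E (bound t) = 4 * ((1 + (eps * Lam) ^+ 2) *
    (alpha t * E (fun x => g x * U t x ^+ 2)) + 2 * (alpha t * E (fun x => nu t x ^+ 2))
    + theta ^+ 2 * (tau t * E (fun x => p t x ^+ 2)) + b ^+ 2 * alpha t).
Proof.
have i1 := L1Z (alpha t) (@sqr_int t); have j1 := L1Z (1 + (eps * Lam) ^+ 2) i1.
have i2 := L1Z (alpha t) (@nu_sqr t); have j2 := L1Z 2 i2.
have i3 := L1Z (tau t) (@p_sqr t); have j3 := L1Z (theta ^+ 2) i3.
have j4 := L1_cst P (b ^+ 2 * alpha t).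
have k2 := L1D j1 j2; have k3 := L1D k2 j3; have k4 := L1D k3 j4.
have e0 := EZ 4 k4; have e1 := ED k3 j4; have e2 := ED k2 j3; have e3 := ED j1 j2.
have e4 := EZ (1 + (eps * Lam) ^+ 2) i1; have e5 := EZ (alpha t) (@sqr_int t).
have e6 := EZ 2 i2; have e7 := EZ (alpha t) (@nu_sqr t).
have e8 := EZ (theta ^+ 2) i3; have e9 := EZ (tau t) (@p_sqr t).
have e10 := E_cst P (b ^+ 2 * alpha t).
by rewrite /bound e0 e1 e2 e3 e4 e5 e6 e7 e8 e9 e10.
Qed.

Let mZ t : measurable_fun setT (Z t : G t.+1 -> R).
Proof.
have aU : measurable_fun setT (U t : G t.+1 -> R) by exact: adaptedS.
have aN : measurable_fun setT (N t : G t.+1 -> R) by exact: adaptedS.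
apply: measurable_funB; last exact: measurable_cst.
apply: measurable_funD; last by apply: measurable_funM; first exact: measurable_cst.
apply: measurable_funD; last by apply: measurable_funM; first exact: measurable_cst.
apply: measurable_funM; last exact: measurable_cst.
by apply: measurable_funB; apply: measurable_funX.
Qed.

Let M_adapted t : measurable_fun setT ((fun x => J t x * Z t x) : G t.+1 -> R).
Proof. by apply: measurable_funM => //; exact: adaptedS. Qed.

Let M_sqr t : L1 (fun x => (J t x * Z t x) ^+ 2).
Proof.
apply: (L1_le (Y := fun x => (tau t)^-1 * bound t x)); last exact: L1Z.
  by apply: measurable_funX; exact: (mT (@M_adapted t)).
by move=> x; rewrite ger0_norm ?sqr_ge0// ler_pdivlMl.
Qed.

Let M_sum n : \sum_(t < n) (t.+1%:R ^+ 2)^-1 * E (fun x => (J t x * Z t x) ^+ 2) <=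
  4 * ((1 + (eps * Lam) ^+ 2) * cw + 2 * (4 * D) + theta ^+ 2 * cp + b ^+ 2 * 4).
Proof.
apply: le_trans (_ : \sum_(t < n) E (bound t) <= _).
  apply: ler_sum => t _; have e := EZ (tau t) (@M_sqr t); rewrite -/(tau t) -e.
  by apply: E_le => //; exact: L1Z.
under eq_bigr do rewrite bound_expect.
rewrite -mulr_sumr !big_split/= -!mulr_sumr ler_pM2l//.
have h1 := weighted_sqr_sum n.
have h2 : \sum_(t < n) alpha t * E (fun x => nu t x ^+ 2) <= 4 * D.
  apply: le_trans (_ : \sum_(t < n) alpha t * D <= _).
    by apply: ler_sum => t _; rewrite ler_wpM2l// ltW.
  by rewrite -mulr_suml ler_wpM2r.
have h3 := p_sum n; have h4 := alpha_sum n.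
rewrite !lerD// ler_wpM2l ?sqr_ge0//.
by rewrite addr_ge0// sqr_ge0.
Qed.

Let M_drift t (xi : T -> R) : measurable_fun setT (xi : G t -> R) ->
  (forall x, 0 <= xi x) -> L1 (fun x => xi x * (J t x * Z t x)) ->
  E (fun x => xi x * (J t x * Z t x)) <= 0.
Proof.
move=> mxi xi0; have -> : (fun x => xi x * (J t x * Z t x)) =
    (fun x => (xi x * J t x) * Z t x) by apply/funext => x; rewrite mulrA.
apply: (cond_nonpos_mul (@F_measurable t)) => //; first exact: measurable_funM.
by move=> x; rewrite mulr_ge0//; case: (J01 t x) => [->|[->]].
Qed.

Lemma lyapunov_drift_law : {ae P, forall x, U 0%N x <= m%:R -> forall r, 0 < r ->
  exists n0, forall t, (n0 <= t)%N ->
    theta * \sum_(s < t) p s x + eps * \sum_(s < t) N s x <= (b + r) * t%:R}.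
Proof.
have := supermartingale_strong_law F_measurable F_mono M_adapted M_sqr M_drift M_sum.
apply: filterS2 weighted_energy_vanishes => x /[swap] Hlaw + xm.
move=> /(_ xm _ ltr01)[n1 Hn1] r r0.
have JE t : (n1 <= t)%N -> J t x = 1.
  by move=> /Hn1 h; rewrite /J /g xm h mulr1.
have [n2 Hn2] := Hlaw (r / 4) (divr_gt0 r0 (ltr0n R 4)).
(* From [n1] on the truncation is inactive, so the sums of [Z] and of [J * Z] differ by this fixed
   amount. *)
pose c := \sum_(s < n1) (Z s x - J s x * Z s x).
have eqc t : (n1 <= t)%N -> \sum_(s < t) (Z s x - J s x * Z s x) = c.
  move=> /subnKC <-; elim: (t - n1)%N => [|k IH]; first by rewrite addn0.
  by rewrite addnS big_ord_recr/= IH JE ?leq_addr// mul1r subrr addr0.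
have ZE t : \sum_(s < t) Z s x = (U t x ^+ 2 - U 0%N x ^+ 2) / 2
    + theta * (\sum_(s < t) p s x) + eps * (\sum_(s < t) N s x) - b * t%:R.
  elim: t => [|t IH]; first by rewrite !big_ord0 subrr; lra.
  by rewrite !big_ord_recr/= IH -[t.+1%:R]natr1 /Z /dL; lra.
(* From time [k] on, [r / 2 * t] absorbs the initial energy and the other constants; [archi_boundP]
   asks for a nonnegative argument, hence the case split. *)
pose k := Num.bound ((c + U 0%N x ^+ 2 + r) / (r / 2)).
have cx : c + U 0%N x ^+ 2 + r <= (r / 2) * k%:R \/ c + U 0%N x ^+ 2 + r <= 0.
  have [neg|pos] := lerP (c + U 0%N x ^+ 2 + r) 0; [by right|left].
  rewrite mulrC -ler_pdivrMr ?divr_gt0//; apply: ltW; apply: archi_boundP.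
  by rewrite divr_ge0// ltW// divr_gt0.
exists (maxn n1 (maxn n2 k)) => t; rewrite !geq_max => /and3P[t1 t2 t3].
have h1 := eqc t t1; have h2 := Hn2 t t2; have h3 := ZE t.
rewrite sumrB in h1; rewrite -[t.+1%:R]natr1 in h2.
have kt : k%:R <= t%:R :> R by rewrite ler_nat.
have h4 := ler_wpM2l (ltW (divr_gt0 r0 (ltr0n R 2))) kt.
have h5 := sqr_ge0 (U t x); have h6 := sqr_ge0 (U 0%N x).
have h7 : 0 <= r / 2 * t%:R by rewrite mulr_ge0// ltW// divr_gt0.
case: cx => cx; lra.
Qed.

End DriftLaw.

End LyapunovCore.

(** * Generators of the history and state sigma-algebras *)

Section History.
Context {d : measure_display} {T : measurableType d} {R : realType}.
Variables (K : nat) (Q : nat -> 'I_K -> T -> R) (p : nat -> T -> R).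
Hypothesis mQ : forall t k, measurable_fun setT (Q t k).
Hypothesis mp : forall t, measurable_fun setT (p t).

(** Named because [g_sigma_algebraType] takes a generating family; [<<s hist_gen t >>] is
    [hist_sigma] by unfolding. *)
Definition hist_gen (t : nat) : set (set T) :=
  [set A | (exists s k (B : set R), (s <= t)%N /\ measurable B /\ A = Q s k @^-1` B)
        \/ (exists s (B : set R), (s < t)%N /\ measurable B /\ A = p s @^-1` B)].

Definition state_gen (t : nat) : set (set T) :=
  [set A | exists k (B : set R), measurable B /\ A = Q t k @^-1` B].

Lemma hist_gen_measurable t : <<s hist_gen t >> `<=` measurable.
Proof.
apply: smallest_sub; first exact: sigma_algebra_measurable.
move=> A [[s [k [B [_ [mB ->]]]]]|[s [B [_ [mB ->]]]]].
  by rewrite -[X in measurable X]setTI; exact: mQ.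
by rewrite -[X in measurable X]setTI; exact: mp.
Qed.

Lemma state_gen_measurable t : <<s state_gen t >> `<=` measurable.
Proof.
apply: smallest_sub; first exact: sigma_algebra_measurable.
by move=> A [k [B [mB ->]]]; rewrite -[X in measurable X]setTI; exact: mQ.
Qed.

Lemma hist_gen_mono t : <<s hist_gen t >> `<=` <<s hist_gen t.+1 >>.
Proof.
apply: smallest_sub; first exact: smallest_sigma_algebra.
move=> A hA; apply: sub_gen_smallest; move: hA => [[s [k [B [st h]]]]|[s [B [st h]]]].
  by left; exists s, k, B; split=> //; exact: leqW.
by right; exists s, B; split=> //; exact: leqW.
Qed.

Lemma queue_adapted t k :
  measurable_fun setT (Q t k : g_sigma_algebraType (hist_gen t) -> R).
Proof.
move=> _ B mB; rewrite setTI; apply: sub_gen_smallest.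
by left; exists t, k, B.
Qed.

Lemma penalty_adapted t :
  measurable_fun setT (p t : g_sigma_algebraType (hist_gen t.+1) -> R).
Proof.
move=> _ B mB; rewrite setTI; apply: sub_gen_smallest.
by right; exists t, B.
Qed.

End History.

(** * The weighted Euclidean norm of the queue vector *)

Section WeightedNorm.
Context {R : realType} {K : nat}.
Variable w : 'I_K -> R.
Hypothesis w0 : forall k, 0 < w k.
Implicit Types q : 'I_K -> R.

(* The shift by [1] keeps the norm away from [0]; its square is [1 + 2 L]. *)
Definition shifted_norm q : R := Num.sqrt (1 + \sum_(k < K) w k * q k ^+ 2).

Let sum_ge0 q : 0 <= \sum_(k < K) w k * q k ^+ 2.
Proof. by apply: sumr_ge0 => k _; rewrite mulr_ge0 ?sqr_ge0 ?ltW. Qed.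

Lemma shifted_norm_sqr q : shifted_norm q ^+ 2 = 1 + \sum_(k < K) w k * q k ^+ 2.
Proof. by rewrite sqr_sqrtr// addr_ge0. Qed.

Lemma shifted_norm_ge1 q : 1 <= shifted_norm q.
Proof. by rewrite -[leLHS]sqrtr1 ler_sqrt ?lerDl// addr_ge0. Qed.

Lemma shifted_norm_Lyap q q' :
  (shifted_norm q' ^+ 2 - shifted_norm q ^+ 2) / 2 = Lyap w q' - Lyap w q.
Proof. by rewrite !shifted_norm_sqr /Lyap; field. Qed.

(** Reverse triangle inequality for the weighted norm of [(1, q)]. Cauchy-Schwarz is read off from
    the squared norm of [v (1, q) - u (1, q')], whose first coordinate contributes
    [(v - u) ^+ 2]. *)
Lemma shifted_norm_increment q q' : (shifted_norm q' - shifted_norm q) ^+ 2 <=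
  \sum_(k < K) w k * (q' k - q k) ^+ 2.
Proof.
set u := shifted_norm q; set v := shifted_norm q'.
have u1 : 1 <= u := shifted_norm_ge1 q; have v1 : 1 <= v := shifted_norm_ge1 q'.
have eu : u ^+ 2 - 1 = \sum_(k < K) w k * q k ^+ 2 by rewrite shifted_norm_sqr addrAC subrr add0r.
have ev : v ^+ 2 - 1 = \sum_(k < K) w k * q' k ^+ 2 by rewrite shifted_norm_sqr addrAC subrr add0r.
pose S := \sum_(k < K) w k * (q k * q' k).
have e1 : \sum_(k < K) w k * (q' k - q k) ^+ 2 = (v ^+ 2 - 1) + (u ^+ 2 - 1) - 2 * S.
  rewrite eu ev /S mulr_sumr -big_split -sumrB.
  by apply: eq_bigr => k _ /=; ring.
have e2 : \sum_(k < K) w k * (v * q k - u * q' k) ^+ 2 =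
    v ^+ 2 * (u ^+ 2 - 1) + u ^+ 2 * (v ^+ 2 - 1) - 2 * u * v * S.
  rewrite eu ev /S !mulr_sumr -big_split -sumrB.
  by apply: eq_bigr => k _ /=; ring.
have p2 : 0 <= \sum_(k < K) w k * (v * q k - u * q' k) ^+ 2.
  by apply: sumr_ge0 => k _; rewrite mulr_ge0 ?sqr_ge0 ?ltW.
have uv : 0 < 2 * (u * v) by have := ler_pM ler01 ler01 u1 v1; lra.
have : 0 <= 2 * (u * v) * (u * v - 1 - S).
  have -> : 2 * (u * v) * (u * v - 1 - S) =
     (\sum_(k < K) w k * (v * q k - u * q' k) ^+ 2) + (v - u) ^+ 2 by rewrite e2; ring.
  by rewrite addr_ge0 ?sqr_ge0.
rewrite (pmulr_rge0 _ uv) => h.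
rewrite e1; lra.
Qed.

(** The crude factor [1 + w k] stands in for the square root of [w k], and the leading 1 keeps the
    constant positive even when [K = 0]. *)
Lemma shifted_norm_le q :
  shifted_norm q <= 1 + (1 + \sum_(k < K) (1 + w k)) * \sum_(k < K) `|q k|.
Proof.
set kap := 1 + \sum_(k < K) (1 + w k); set N := \sum_(k < K) `|q k|.
have kw k : 1 + w k <= kap.
  rewrite /kap (bigD1 k)//= addrCA lerDl addr_ge0// sumr_ge0// => i _.
  by rewrite addr_ge0 ?ltW.
have kap1 : 0 <= kap.
  by rewrite addr_ge0// sumr_ge0// => i _; rewrite addr_ge0 ?ltW.
have N0 : 0 <= N by apply: sumr_ge0.
have kN : 0 <= kap * N by exact: mulr_ge0.
rewrite -(@ler_pXn2r _ 2) ?nnegrE ?sqrtr_ge0 ?addr_ge0// shifted_norm_sqr.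
have h : \sum_(k < K) w k * q k ^+ 2 <= (kap * N) ^+ 2.
  apply: le_trans (_ : (\sum_(k < K) (1 + w k) * `|q k|) ^+ 2 <= _).
    apply: le_trans (sum_sqr_le_sqr_sum _ _) => [|k].
      apply: ler_sum => k _; rewrite exprMn real_normK ?num_real//.
      by rewrite ler_wpM2r ?sqr_ge0//; have := ltW (w0 k); nra.
    by rewrite mulr_ge0// addr_ge0 ?ltW.
  rewrite ler_pXn2r ?nnegrE//; last first.
    by apply: sumr_ge0 => k _; rewrite mulr_ge0// addr_ge0 ?ltW.
  by rewrite /N mulr_sumr; apply: ler_sum => k _; rewrite ler_wpM2r.
rewrite sqrrD; nra.
Qed.

Lemma coord_le_shifted_norm q k : w k * q k ^+ 2 <= shifted_norm q ^+ 2.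
Proof.
rewrite shifted_norm_sqr (bigD1 k)//=.
have : 0 <= \sum_(i < K | i != k) w i * q i ^+ 2.
  by apply: sumr_ge0 => i _; rewrite mulr_ge0 ?sqr_ge0 ?ltW.
lra.
Qed.

Lemma sum_norm_le q :
  \sum_(k < K) `|q k| <= (\sum_(k < K) (1 + (w k)^-1)) * shifted_norm q.
Proof.
rewrite mulr_suml; apply: ler_sum => k _.
have u1 := shifted_norm_ge1 q; have iw0 : 0 < (w k)^-1 by rewrite invr_gt0.
rewrite -(@ler_pXn2r _ 2) ?nnegrE ?mulr_ge0 ?sqrtr_ge0 ?addr_ge0 ?(ltW iw0)//.
rewrite exprMn real_normK ?num_real//.
apply: le_trans (_ : (w k)^-1 * shifted_norm q ^+ 2 <= _).
  by rewrite ler_pdivlMl//; exact: coord_le_shifted_norm.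
by rewrite ler_wpM2r ?sqr_ge0//; nra.
Qed.

End WeightedNorm.

(** * From the queueing hypotheses to the abstract process *)

Theorem theorem2 (d : measure_display) (T : measurableType d) (R : realType)
  (P : probability T R) (K : nat) (Q : nat -> 'I_K -> T -> R) (p : nat -> T -> R)
  (w : 'I_K -> R) (pmin D B pstar V eps : R) :
  (forall t k, measurable_fun setT (Q t k)) ->
  (forall t, measurable_fun setT (p t)) ->
  (forall k, 0 < w k) ->
  (* (i) *)
  (forall t, P.-integrable setT (fun x => (p t x ^+ 2)%:E)) ->
  (\sum_(1 <= tau <oo) ((\int[P]_x (p tau x ^+ 2)%:E) * ((tau%:R ^+ 2)^-1)%:E)
     < +oo)%E ->
  (* (ii) *)
  (forall t, exists g, is_cond_exp P (hist_sigma Q p t) (p t) g /\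
                       {ae P, forall x, pmin <= g x}) ->
  (* (iii) *)
  0 < D ->
  (forall t (k : 'I_K), exists g,
      is_cond_exp P (state_sigma Q t) (fun x => (Q t.+1 k x - Q t k x) ^+ 4) g /\
      {ae P, forall x, g x <= D}) ->
  (* (v), with V >= 0 (V = 0 covers the final claim) *)
  0 <= V -> 0 < eps ->
  (forall t, exists gD gp,
      is_cond_exp P (hist_sigma Q p t)
        (fun x => Lyap w (fun k => Q t.+1 k x) - Lyap w (fun k => Q t k x)) gD /\
      is_cond_exp P (hist_sigma Q p t) (p t) gp /\
      {ae P, forall x, gD x + V * gp x
                       <= B + V * pstar - eps * \sum_(k < K) `|Q t k x|}) ->
  (0 < V ->
     {ae P, forall x, (limn_esup (fun t : nat =>
        ((t%:R)^-1 * \sum_(tau < t) p tau x)%:E) <= (pstar + B / V)%:E)%E}) /\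
  {ae P, forall x, (limn_esup (fun t : nat =>
        ((t%:R)^-1 * \sum_(tau < t) \sum_(k < K) `|Q tau k x|)%:E)
        <= ((B + V * (pstar - pmin)) / eps)%:E)%E} /\
  (forall k : 'I_K, {ae P, forall x, (fun t : nat => Q t k x / t%:R) @ \oo --> 0}).
Proof.
move=> mQ mp w0 Hp2 Hpsum Hpmin D0 HD V0 eps0 Hdrift.
pose F := hist_gen Q p.
have Fm t : <<s F t >> `<=` measurable := hist_gen_measurable mQ mp (t := t).
have FS t : <<s F t >> `<=` <<s F t.+1 >> := @hist_gen_mono _ _ _ _ Q p t.
pose U t x := shifted_norm w (fun k => Q t k x).
pose N t x := \sum_(k < K) `|Q t k x|.
pose nu t x := \sum_(k < K) w k * (Q t.+1 k x - Q t k x) ^+ 2.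
pose kap := 1 + \sum_(k < K) (1 + w k).
have kap0 : 0 < kap.
  by rewrite ltr_wpDr// sumr_ge0// => k _; rewrite addr_ge0 ?ltW.
(* Chosen so that [shifted_norm_le] turns the drift [eps * N] into at least [eta * (U - 1)]. *)
pose eta := eps / kap.
have eta0 : 0 < eta by rewrite divr_gt0.
have aQ t k : measurable_fun setT (Q t k : g_sigma_algebraType (F t) -> R).
  exact: queue_adapted.
have aU t : measurable_fun setT (U t : g_sigma_algebraType (F t) -> R).
  apply: measurableT_comp.
    by apply: continuous_measurable_fun; exact: sqrt_continuous.
  apply: measurable_funD; first exact: measurable_cst.
  apply: measurable_sum => k; apply: measurable_funM; first exact: measurable_cst.
  exact: measurable_funX.
have aN t : measurable_fun setT (N t : g_sigma_algebraType (F t) -> R).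
  by apply: measurable_sum => k; exact: measurableT_comp.
have ap t : measurable_fun setT (p t : g_sigma_algebraType (F t.+1) -> R).
  exact: penalty_adapted.
have mnu t : measurable_fun setT (nu t).
  apply: measurable_sum => k; apply: measurable_funM; first exact: measurable_cst.
  by apply: measurable_funX; exact: measurable_funB.
have U1 t x : 1 <= U t x by exact: shifted_norm_ge1.
have N0 t x : 0 <= N t x by apply: sumr_ge0.
have U_le t x : eta * (U t x - 1) <= eps * N t x.
  have h := shifted_norm_le w0 (fun k => Q t k x).
  rewrite /eta mulrAC ler_pdivrMr// -mulrA ler_wpM2l ?(ltW eps0)//.
  by rewrite lerBlDl mulrC.
have N_le t x : N t x <= (\sum_(k < K) (1 + (w k)^-1)) * U t x by exact: sum_norm_le.
have U_inc t x : (U t.+1 x - U t x) ^+ 2 <= nu t x by exact: shifted_norm_increment.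
have delta4 t k :
    P.-integrable setT (EFin \o (fun x => (Q t.+1 k x - Q t k x) ^+ 4)) /\
    Rintegral P setT (fun x => (Q t.+1 k x - Q t k x) ^+ 4) <= D.
  have [g [hg gD]] := HD t k.
  have m4 : measurable_fun setT (fun x => (Q t.+1 k x - Q t k x) ^+ 4).
    by apply: measurable_funX; exact: measurable_funB.
  have Sm := state_gen_measurable mQ (t := t).
  apply: (cond_bound_expectation Sm) => //.
  - by move=> x; rewrite exprn_even_ge0.
  - exact: ltW.
  have [h1 _] := cond_nonpos_cond_exp Sm m4 hg.
  have h2 : cond_nonpos P (state_gen Q t) (fun x => g x - D).
    apply: (cond_nonpos_adapted Sm).
      apply: measurable_funB; last exact: measurable_cst.
      by move=> _ B' mB; rewrite setTI; exact: hg.1.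
    by apply: filterS gD => x; rewrite subr_le0.
  have := cond_nonposD Sm h1 h2.
  by under eq_fun do rewrite addrA subrK.
(* Cauchy-Schwarz over the [K] coordinates bounds [nu ^+ 2] by [nu4], whose expectation is at most
   [D1]. *)
pose D1 := K%:R * \sum_(k < K) w k ^+ 2 * D.
pose nu4 t x := K%:R * \sum_(k < K) w k ^+ 2 * (Q t.+1 k x - Q t k x) ^+ 4.
have nu4_int t : P.-integrable setT (EFin \o nu4 t).
  by apply: L1Z; apply: L1_sum => k; apply: L1Z; exact: (delta4 t k).1.
have nu_le t x : nu t x ^+ 2 <= nu4 t x.
  have := sqr_sum_le (index_enum 'I_K) (fun k => w k * (Q t.+1 k x - Q t k x) ^+ 2).
  rewrite /nu4 [size _](_ : _ = K).
    by under [X in _ <= _ * X -> _]eq_bigr do rewrite exprMn -exprM.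
  by rewrite /index_enum -enumT size_enum_ord.
have nu_sqr t : P.-integrable setT (EFin \o (fun x => nu t x ^+ 2)).
  apply: (L1_le (Y := nu4 t)) => //; first exact: measurable_funX.
  by move=> x; rewrite ger0_norm ?sqr_ge0.
have nu_bound t : Rintegral P setT (fun x => nu t x ^+ 2) <= D1.
  apply: le_trans (_ : Rintegral P setT (nu4 t) <= _); first exact: E_le.
  have ik k := (delta4 t k).1.
  have iwk k := L1Z (w k ^+ 2) (ik k).
  have -> := EZ K%:R (L1_sum (index_enum 'I_K) iwk).
  have -> := E_sum (index_enum 'I_K) iwk.
  rewrite ler_wpM2l//; apply: ler_sum => k _; have -> := EZ (w k ^+ 2) (ik k).
  by rewrite ler_wpM2l ?sqr_ge0//; exact: (delta4 t k).2.
have [cp Hcp] : exists cp, forall n,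
    \sum_(t < n) (t.+1%:R ^+ 2)^-1 * Rintegral P setT (fun x => p t x ^+ 2) <= cp.
  pose e (t : nat) := ((\int[P]_x (p t x ^+ 2)%:E) * ((t%:R ^+ 2)^-1)%:E)%E.
  have e0 t : (0 <= e t)%E.
    apply: mule_ge0; last by rewrite lee_fin invr_ge0 exprn_ge0.
    by apply: integral_ge0 => x _; rewrite lee_fin sqr_ge0.
  have eE t : e t = ((t%:R ^+ 2)^-1 * Rintegral P setT (fun x => p t x ^+ 2))%:E.
    by rewrite /e (E_fin (Hp2 t)) -EFinM mulrC.
  pose S := fine (\sum_(1 <= t <oo) e t).
  have Sfin : (\sum_(1 <= t <oo) e t = S%:E)%E.
    by rewrite fineK// ge0_fin_numE//; apply: nneseries_ge0.
  have Ep0 t : 0 <= Rintegral P setT (fun x => p t x ^+ 2).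
    by apply: E_ge0 => x; exact: sqr_ge0.
  (* The weights are shifted by one: time 0 is added separately with weight 1, and later terms use
     [1 / (t + 1)^2 <= 1 / t^2]. *)
  exists (Rintegral P setT (fun x => p 0 x ^+ 2) + S) => -[|n].
    rewrite big_ord0 addr_ge0//; rewrite -lee_fin -Sfin; exact: nneseries_ge0.
  rewrite big_ord_recl/= expr1n invr1 mul1r lerD2l -lee_fin -Sfin.
  have := @nneseries_lim_ge R e xpredT 1 n.+1 (fun t _ _ => e0 t).
  apply: le_trans; rewrite big_add1/= big_mkord -sumEFin.
  apply: lee_sum => t _; rewrite eE lee_fin ler_wpM2r//.
  by rewrite lef_pV2 ?posrE ?exprn_gt0// ler_pXn2r ?nnegrE// ler_nat.
have dLE t x : (U t.+1 x ^+ 2 - U t x ^+ 2) / 2 =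
    Lyap w (fun k => Q t.+1 k x) - Lyap w (fun k => Q t k x).
  exact: shifted_norm_Lyap.
have mLyap t : measurable_fun setT (fun x => Lyap w (fun k => Q t k x)).
  apply: measurable_funM; first exact: measurable_cst.
  apply: measurable_sum => k; apply: measurable_funM; first exact: measurable_cst.
  exact: measurable_funX.
(* The differences [X - E[X | H(t)]] for the Lyapunov increment and for [p] are added to (v), which
   cancels the versions [gD] and [gp]. *)
have driftV t : cond_nonpos P (F t) (fun x => (U t.+1 x ^+ 2 - U t x ^+ 2) / 2
    + V * p t x + eps * N t x - (B + V * pstar)).
  have [gD [gp [hD [hp hle]]]] := Hdrift t.
  have [h1 _] := cond_nonpos_cond_exp (@Fm t) (measurable_funB (mLyap t.+1) (mLyap t)) hD.
  have [h2 _] := cond_nonpos_cond_exp (@Fm t) (mp t) hp.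
  have h3 : cond_nonpos P (F t)
      (fun x => gD x + V * gp x - (B + V * pstar - eps * N t x)).
    apply: (cond_nonpos_adapted (@Fm t)).
      have agD : measurable_fun setT (gD : g_sigma_algebraType (F t) -> R).
        by move=> _ B' mB; rewrite setTI; exact: hD.1.
      have agp : measurable_fun setT (gp : g_sigma_algebraType (F t) -> R).
        by move=> _ B' mB; rewrite setTI; exact: hp.1.
      apply: measurable_funB.
        by apply: measurable_funD => //; apply: measurable_funM => //; exact: measurable_cst.
      apply: measurable_funB; first exact: measurable_cst.
      by apply: measurable_funM => //; exact: measurable_cst.
    by apply: filterS hle => x; rewrite subr_le0.
  have := cond_nonposD (@Fm t) (cond_nonposD (@Fm t) h1 (cond_nonposZ (@Fm t) V0 h2)) h3.
  congr (cond_nonpos P (F t)); apply/funext => x /=; rewrite dLE; ring.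
pose C := B + V * (pstar - pmin).
(* Adding [V] times [pmin - p], of nonpositive conditional expectation by (ii), removes the
   penalty. *)
have drift0 t : cond_nonpos P (F t) (fun x => (U t.+1 x ^+ 2 - U t x ^+ 2) / 2
    + eps * N t x - C).
  have [g [hg gmin]] := Hpmin t.
  have [_ h1] := cond_nonpos_cond_exp (@Fm t) (mp t) hg.
  have h2 : cond_nonpos P (F t) (fun x => pmin - g x).
    apply: (cond_nonpos_adapted (@Fm t)).
      apply: measurable_funB; first exact: measurable_cst.
      by move=> _ B' mB; rewrite setTI; exact: hg.1.
    by apply: filterS gmin => x; rewrite subr_le0.
  have := cond_nonposD (@Fm t) (driftV t)
    (cond_nonposZ (@Fm t) V0 (cond_nonposD (@Fm t) h1 h2)).
  congr (cond_nonpos P (F t)); apply/funext => x /=; rewrite /C; ring.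
have drift0' t : cond_nonpos P (F t) (fun x => (U t.+1 x ^+ 2 - U t x ^+ 2) / 2
    + 0 * p t x + eps * N t x - C).
  have := drift0 t; congr (cond_nonpos P (F t)); apply/funext => x /=; ring.
have [alpha [al0 alS alge alsum alcube]] := @four_thirds_weight R.
have vanish m := weighted_energy_vanishes Fm FS aU aN U1 N0 eps0 eta0 U_le N_le
  U_inc nu_sqr nu_bound drift0 m al0 alS alsum.
have law theta b (h : forall t, cond_nonpos P (F t) (fun x =>
    (U t.+1 x ^+ 2 - U t x ^+ 2) / 2 + theta * p t x + eps * N t x - b)) m :=
  lyapunov_drift_law Fm FS aU aN ap U1 N0 eps0 eta0 U_le N_le
  U_inc nu_sqr nu_bound Hp2 Hcp drift0 m al0 alS alsum alcube alge h.
have Um x : exists m : nat, U 0%N x <= m%:R.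
  by exists (Num.bound (U 0%N x)); apply/ltW/archi_boundP; apply: le_trans (U1 0%N x).
have avg_le (S : nat -> R) (a b c : R) : 0 < a ->
    (forall r, 0 < r -> exists n0, forall t, (n0 <= t)%N -> a * S t <= (b + r) * t%:R) ->
    (limn_esup (fun t => (t%:R^-1 * S t)%:E) <= (b / a)%:E)%E.
  move=> a0 H; apply: limn_esup_le => r r0.
  (* The slack is scaled by [a] since the bound is divided by [a]; starting at [n0.+1] excludes the
     division by [t = 0]. *)
  have [n0 Hn0] := H (r * a) (mulr_gt0 r0 a0); exists n0.+1 => -[//|t] nt.
  rewrite mulrC ler_pdivrMr ?ltr0n// -(ler_pM2l a0).
  apply: le_trans (Hn0 t.+1 (ltnW nt)) _.
  rewrite le_eqVlt; apply/orP; left; apply/eqP; field.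
  by rewrite gt_eqF.
split=> [Vpos|]; last split=> [|k].
- have := ae_foralln (law V (B + V * pstar) driftV).
  apply: filterS => x Hx; have [m Hm] := Um x.
  have -> : pstar + B / V = (B + V * pstar) / V by field; rewrite gt_eqF.
  apply: avg_le => // r r0; have [n0 Hn0] := Hx m Hm r r0.
  exists n0 => t /Hn0; apply: le_trans; rewrite lerDl mulr_ge0 ?(ltW eps0)//.
  exact: sumr_ge0.
- have := ae_foralln (law 0 C drift0').
  apply: filterS => x Hx; have [m Hm] := Um x.
  apply: avg_le => // r r0; have [n0 Hn0] := Hx m Hm r r0.
  by exists n0 => t /Hn0; rewrite mul0r add0r.
have := ae_foralln vanish; apply: filterS => x Hx; have [m Hm] := Um x.
apply/cvgrPdist_le => e e0.
(* The 4 pays for [(t + 2)^2 <= 4 (t + 1)^2], as the weight at time [t + 1] is at least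
   [1 / (t + 2)^2]; the factor [w k] converts [U^2] into [Q_k^2]. *)
have r0 : 0 < e ^+ 2 * w k / 4 by rewrite divr_gt0// mulr_gt0// exprn_gt0.
have [n0 Hn0] := Hx m Hm _ r0.
exists n0.+1 => // -[//|t] /= nt; rewrite sub0r normrN normrM normfV (ger0_norm (ler0n _ t.+1)).
rewrite ler_pdivrMr ?ltr0n// -(@ler_pXn2r _ 2) ?nnegrE ?mulr_ge0 ?(ltW e0)//.
rewrite real_normK ?num_real// -(ler_pM2l (w0 k)).
apply: le_trans (coord_le_shifted_norm w0 (fun k => Q t.+1 k x) k) _.
have := Hn0 t.+1 (ltnW nt); rewrite -/(U t.+1 x).
have := ler_wpM2r (sqr_ge0 (U t.+1 x)) (alge t.+1) => /le_trans h /h {h}.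
rewrite ler_pdivrMl ?exprn_gt0// => h; apply: le_trans h _.
have t2 : t.+2%:R ^+ 2 <= 4 * t.+1%:R ^+ 2 :> R.
  have -> : 4 * t.+1%:R ^+ 2 = (2 * t.+1%:R) ^+ 2 :> R by ring.
  by rewrite ler_pXn2r ?nnegrE ?mulr_ge0// -natrM ler_nat mul2n doubleS !ltnS -addnn leq_addr.
apply: le_trans (ler_wpM2r (ltW r0) t2) _.
by rewrite le_eqVlt; apply/orP; left; apply/eqP; field.
Qed.
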